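(* Let $G$ be a finite connected graph (multiple edges allowed, no loops) of order $n\ge 2$ and size $m\ge 2$, with distinct terminals $s$ and $t$, such that every edge of $G$ lies on some path between $s$ and $t$. Assume further that $G$ is not an $s$-$t$ path (i.e. $G$ is not a path graph with end vertices $s$ and $t$). Let $T(p)=\mathrm{Rel}_{s,t}(G;p)$ be the two-terminal reliability polynomial of $(G,s,t)$, and let $\mathcal{T}(G,s,t)$ be the two-terminal attractor of $(G,s,t)$. Then: (i) if $s$ and $t$ are adjacent in $G$, then $\mathcal{T}(G,s,t)$ is the Julia set of $T$; (ii) if $s$ and $t$ are nonadjacent in $G$, then $\mathcal{T}(G,s,t)$ can be partitioned into the inverse orbit of $0$ under $T$ and the Julia set of $T$; that is, $\mathcal{T}(G,s,t)$ is the disjoint union of $\bigcup_{k\ge 1}T^{-\circ k}(\{0\})$ and the Julia set of $T$.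
   Context: Graphs are finite, undirected and connected, may have multiple edges, and have no loops. The order and size of a graph are its numbers of vertices and edges, respectively. Two-terminal reliability: for a graph $G$ with $m$ edges and distinct vertices $s,t$ (terminals), $$\mathrm{Rel}_{s,t}(G;p)=\sum_{S\in\mathcal{S}_G}p^{|S|}(1-p)^{m-|S|},$$ where $\mathcal{S}_G$ is the collection of subsets $S\subseteq E(G)$ such that the spanning subgraph of $G$ with edge set $S$ contains an $s$-$t$ path (this is the probability that $s$ and $t$ are connected by operational edges when each edge is independently operational with probability $p$). It is regarded as a polynomial in a complex variable; its complex roots are the two-terminal roots of $(G,s,t)$. Edge substitution: if $H$ is a graph with two distinct distinguished vertices $u,v$, then $G[H(u,v)]$ denotes any graph formed by replacing each edge $\{x,y\}$ of $G$ by its own copy of $H$ (the copies being disjoint from each other and from $G$), identifying $u$ with $x$ and $v$ with $y$. Two-terminal attractor: set $G_1=G$ and $G_i=G[G_{i-1}(s,t)]$ for $i\ge 2$, each with terminals $s,t$. With $T=\mathrm{Rel}_{s,t}(G;p)$, the two-terminal attractor is $$\mathcal{T}(G,s,t)=\overline{\bigcup_{k\ge 1}\{z\in\mathbb{C}: z\text{ is a root of }\mathrm{Rel}_{s,t}(G_k;p)\}}=\overline{\bigcup_{k\ge 1}T^{-\circ k}(\{0\})},$$ the closure being taken in $\mathbb{C}$. Here $T^{\circ k}$ is the $k$-fold composition of $T$ with itself and $T^{-\circ k}(\{0\})=\{z\in\mathbb{C}:T^{\circ k}(z)=0\}$; the set $\bigcup_{k\ge 1}T^{-\circ k}(\{0\})$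 is the inverse orbit of $0$ under $T$. The Julia set is the usual Julia set of a polynomial viewed as a rational map in complex dynamics. *)

(* Defs.v *)
From HB Require Import structures.
From mathcomp Require Import all_boot all_order all_algebra.
From mathcomp Require Import all_classical all_reals all_analysis.
From mathcomp Require Import complex.

Set Implicit Arguments.
Unset Strict Implicit.
Unset Printing Implicit Defensive.

Import Order.TTheory GRing.Theory Num.Theory.
Import numFieldNormedType.Exports.

Local Open Scope ring_scope.
Local Open Scope classical_set_scope.

(* A finite loopless multigraph.  The order of the two ends of an edge carries
   no meaning: every notion below is symmetric in them, and edge substitution
   is taken over all choices of orientations. *)
Record mgraph := MGraph {
  vertex : finType;
  edge : finType;
  ends : edge -> vertex * vertex;
  ends_neq : forall e, (ends e).1 != (ends e).2 }.

Record ttgraph := TTGraph {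
  tt_graph :> mgraph;
  src : vertex tt_graph;
  tgt : vertex tt_graph;
  src_neq_tgt : src != tgt }.

Definition joins (G : mgraph) (e : edge G) (x y : vertex G) : bool :=
  (ends e == (x, y)) || (ends e == (y, x)).

(* Adjacency in the spanning subgraph with edge set S. *)
Definition adj_in (G : mgraph) (S : {set edge G}) : rel (vertex G) :=
  fun x y => [exists e in S, joins e x y].

Definition adj (G : mgraph) : rel (vertex G) := adj_in [set: edge G].

Definition connected_graph (G : mgraph) : Prop :=
  forall x y : vertex G, connect (@adj G) x y.

(* A walk leaving x is recorded as its list of steps (edge, vertex reached). *)
Fixpoint walk (G : mgraph) (x : vertex G) (w : seq (edge G * vertex G)) : bool :=
  if w is (e, y) :: w' then joins e x y && walk y w' else true.

Definition st_path (G : ttgraph) (w : seq (edge G * vertex G)) : bool :=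
  [&& walk (src G) w, last (src G) (unzip2 w) == tgt G
    & uniq (src G :: unzip2 w)].

Definition on_st_path (G : ttgraph) (e : edge G) : Prop :=
  exists2 w, st_path w & e \in unzip1 w.

(* G itself is a path graph with end vertices the two terminals. *)
Definition is_st_path (G : ttgraph) : Prop :=
  exists w : seq (edge G * vertex G),
    [/\ st_path w, forall e, e \in unzip1 w
      & forall x, x \in src G :: unzip2 w].

Definition Rel (K : nzRingType) (G : ttgraph) : {poly K} :=
  \sum_(S : {set edge G} | connect (adj_in S) (src G) (tgt G))
    'X ^+ #|S| * (1 - 'X) ^+ (#|edge G| - #|S|).

(* Edge substitution G[H(u,v)], where u, v are the terminals of H.
   The vertices are those of G together with, for each edge of G, a copy of
   the vertices of H other than the terminals u, v; the edges are pairs of an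
   edge of G and an edge of H.  [o e] tells which end of e is identified with
   u and which with v, so that the possible graphs G[H(u,v)] are the
   [subst_graph H o] for all o. *)
Section Substitution.
Variables (G : mgraph) (H : ttgraph) (o : edge G -> bool).

Definition inner := {w : vertex H | (w != src H) && (w != tgt H)}.

Definition subst_vertex : finType := (vertex G + edge G * inner)%type.

Definition subst_embed (e : edge G) (w : vertex H) : subst_vertex :=
  let: (x, y) := if o e then ((ends e).2, (ends e).1) else ends e in
  if w == src H then inl x else if w == tgt H then inl y else
  if insub w is Some i then inr (e, i) else inl x (* unreachable *).

Definition subst_ends (f : edge G * edge H) : subst_vertex * subst_vertex :=
  (subst_embed f.1 (ends f.2).1, subst_embed f.1 (ends f.2).2).

Lemma subst_embed_inj e : injective (subst_embed e).
Proof.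
move=> w1 w2; rewrite /subst_embed.
have : (if o e then ((ends e).2, (ends e).1) else ends e).1
         != (if o e then ((ends e).2, (ends e).1) else ends e).2.
  by case: (o e); rewrite ?ends_neq // eq_sym ends_neq.
case: (if o e then _ else _) => a b /= ab.
have [->|s1] := eqVneq w1 (src H); have [->|s2] := eqVneq w2 (src H) => //.
- have [_ [ba]|t2] := eqVneq w2 (tgt H); first by rewrite ba eqxx in ab.
  by rewrite insubT ?s2.
- have [_ [ba]|t1] := eqVneq w1 (tgt H); first by rewrite ba eqxx in ab.
  by rewrite insubT ?s1.
have [->|t1] := eqVneq w1 (tgt H); have [->|t2] := eqVneq w2 (tgt H) => //.
- by rewrite insubT ?s2.
- by rewrite insubT ?s1.
by rewrite !insubT ?s1 ?s2 //= => ? ? [].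
Qed.

Lemma subst_ends_neq f : (subst_ends f).1 != (subst_ends f).2.
Proof. by rewrite /= (inj_eq (@subst_embed_inj _)) ends_neq. Qed.

Definition subst_graph : mgraph := MGraph subst_ends_neq.

End Substitution.

Lemma subst_terminals_neq (G H : ttgraph) (o : edge G -> bool) :
  (inl (src G) : vertex (subst_graph H o)) != inl (tgt G).
Proof. exact: src_neq_tgt. Qed.

Definition subst_tt (G H : ttgraph) (o : edge G -> bool) : ttgraph :=
  TTGraph (subst_terminals_neq H o).

(* [iter_subst o k] is G_{k+1}: G_1 = G and G_{k+2} = G[G_{k+1}(s,t)], the
   substitution producing G_{k+2} being made with the orientations [o k]. *)
Fixpoint iter_subst (G : ttgraph) (o : nat -> edge G -> bool) (k : nat)
    : ttgraph :=
  if k is j.+1 then subst_tt (iter_subst o j) (o j) else G.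

(* [R[i]^o] is the field R[i] with its usual (norm) topology. *)
Definition attractor (R : realType) (G : ttgraph) (o : nat -> edge G -> bool)
    : set R[i]^o :=
  closure (\bigcup_k
    [set z : R[i]^o | root (Rel R[i] (iter_subst o k)) (z : R[i])]).

Arguments attractor R {G} o.

Definition inverse_orbit (R : realType) (p : {poly R[i]}) : set R[i]^o :=
  \bigcup_(k in [set k | (1 <= k)%N]) [set z : R[i]^o | iter k (horner p) z = 0].

(* [Some z] is the finite point z and [None] is the point at infinity. *)
Definition riemann_sphere (R : realType) : Type := option R[i].

(* Inverse stereographic projection onto the unit sphere of R^3. *)
Definition stereo (R : realType) (a : riemann_sphere R) : R * R * R :=
  if a is Some z then
    let x := complex.Re z in let y := complex.Im z in
    let n := x ^+ 2 + y ^+ 2 in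
    (2 * x / (n + 1), 2 * y / (n + 1), (n - 1) / (n + 1))
  else (0, 0, 1).

(* Only the uniform structure matters below, so the max metric of R^3 serves
   as well as the chordal or the spherical one. *)
HB.instance Definition _ (R : realType) := Pointed.copy (riemann_sphere R) (option R[i]).
HB.instance Definition _ (R : realType) :=
  PseudoMetric.copy (riemann_sphere R) (initial_topology (@stereo R)).

(* The rational map of the sphere defined by p: it fixes infinity, unless p is
   constant. *)
Definition sphere_map (R : realType) (p : {poly R[i]}) (a : riemann_sphere R)
    : riemann_sphere R :=
  if a is Some z then Some p.[z]
  else if (size p <= 1)%N then Some p`_0 else None.

(* Union of all open sets of equicontinuity, i.e. the largest one. *)
Definition Fatou (R : realType) (f : riemann_sphere R -> riemann_sphere R)
    : set (riemann_sphere R) :=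
  \bigcup_(U in [set U | open U /\
      {in U, equicontinuous [set: nat] (fun n => iter n f)}]) U.

Definition Julia (R : realType) (p : {poly R[i]}) : set (riemann_sphere R) :=
  ~` Fatou (sphere_map p).

(* Main.v *)
Require Import Defs.
From HB Require Import structures.
From mathcomp Require Import all_boot all_order all_algebra.
From mathcomp Require Import all_classical all_reals all_analysis.
From mathcomp Require Import complex.
From mathcomp Require Import cyclic separable cyclotomic.
From mathcomp Require Import ring lra zify.
Import Order.TTheory GRing.Theory Num.Theory.
Import numFieldNormedType.Exports.
Local Open Scope ring_scope.
Local Open Scope classical_set_scope.
Set Implicit Arguments.
Unset Strict Implicit.
Unset Printing Implicit Defensive.

(** Write T for the two-terminal reliability polynomial of the graph.

    Replacing every edge by a copy of H turns an edge probability p into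
    Rel(H; p), so reliability of a substitution is a composition (Rel_subst).
    The roots of the reliabilities of the iterated graphs are therefore the
    iterated preimages of 0 under T, and the attractor is the closure of the
    inverse orbit of 0.

    Because the graph is not a path between its terminals, T is not a
    monomial (Rel_monomial_path).  Hence T has a root other than its fixed
    point 0, has degree at least 2, and 0 has infinitely many distinct iterated
    preimages.

    The Julia set lies in that closure (Fatou_off_closure).  Let a disc miss
    the inverse orbit.  If its centre escapes to infinity, it is in the Fatou
    set.  If all orbits of a smaller disc are bounded, a Schwarz estimate gives
    equicontinuity.  The remaining case, a centre z0 with bounded orbit and an
    escaping point z1 close to it, is where Montel's theorem is usually quoted;
    here it is excluded by an elementary estimate (omitted_values_bound,
    orbit_stays_bounded).  Let N be the degree of the n-th iterate P of T and
    let a_1, ..., a_m be distinct preimages of 0.  Then P omits each a_i on the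
    disc, so h = (1/N) log |(P - a_1) ... (P - a_m)| is harmonic there.  A
    point can be close to only one a_i, and a single factor satisfies
    |P(z) - a_i| >= 3^-N |P(z1) - a_i| on the half disc; hence h is bounded
    below independently of m, up to an error tending to 0 with n.  At z0 it is
    at most about 0, while at z1 it grows linearly in m.  For m large this
    contradicts the mean value property.  For polynomials that property, used
    on k points of a circle, is the identity
    prod_j (x - y w^j) = x^k - y^k for a primitive k-th root of unity w.

    If the terminals are adjacent, T(x) > x on (0, 1)
    (Rel_gt_id), so the orbits of arbitrarily small positive numbers climb
    towards 1 while 0 is fixed: equicontinuity fails at every iterated preimage
    of 0, and these points and their limits are in the Julia set.

    If they are not adjacent, X^2 divides T and 0 is superattracting.  Iterated
    preimages of 0 are then in the Fatou set, and a limit of such points that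
    lies in the Fatou set has an orbit reaching the disc around 0 on which 0 is
    the only preimage of 0, so it is itself an iterated preimage
    (closure_in_Fatou). *)

(** * Reliability as a sum of weights, and edge substitution *)

Definition connecting (G : ttgraph) (S : {set edge G}) : bool :=
  connect (adj_in S) (src G) (tgt G).

(** The two factors are arbitrary ring elements, so that the same sums serve for
    polynomials, for their compositions and for their values. *)
Definition weight (K : pzRingType) (I : finType) (a b : K) (S : {set I}) : K :=
  a ^+ #|S| * b ^+ (#|I| - #|S|).

Lemma weightE (K : comNzRingType) (I : finType) (a b : K) (S : {set I}) :
  weight a b S = \prod_i (if i \in S then a else b).
Proof.
rewrite /weight (bigID (mem S)) /=; congr (_ * _).
  by rewrite -prodr_const; apply: eq_bigr => i ->.
have -> : (#|I| - #|S| = #|~: S|)%N by rewrite -(cardsC S) addKn.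
rewrite -prodr_const; apply: eq_big => i; first by rewrite inE.
by rewrite inE => /negbTE ->.
Qed.

Lemma sum_weight (K : comNzRingType) (I : finType) (a : K) :
  \sum_(S : {set I}) weight a (1 - a) S = 1.
Proof.
under eq_bigr do rewrite weightE.
by rewrite -bigA_distr; apply: big1 => i _; rewrite /= addrC subrK.
Qed.

(** Only the elements outside P are free, and their factors a and 1 - a add up
    to 1. *)
Lemma sum_weight_supset (K : comNzRingType) (I : finType) (a : K) (P : {set I}) :
  \sum_(S : {set I} | P \subset S) weight a (1 - a) S = a ^+ #|P|.
Proof.
pose f i := if i \in P then 0 else 1 - a.
transitivity (\prod_i (a + f i)); last first.
  rewrite (bigID (mem P)) /= [X in _ * X]big1 ?mulr1.
    rewrite -prodr_const; apply: eq_bigr => i iP; by rewrite /f iP addr0.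
  by move=> i /negbTE iP; rewrite /f iP addrC subrK.
rewrite bigA_distr big_mkcond /=; apply: eq_bigr => S _.
case: ifPn => [/fintype.subsetP PS|/subsetPn [i iP iS]].
  rewrite weightE; apply: eq_bigr => i _; rewrite /f.
  by case: ifPn => // iS; case: ifPn => // /PS; rewrite (negbTE iS).
by rewrite (bigD1 i) //= (negbTE iS) /f iP mul0r.
Qed.

Lemma comp_Rel (K : comNzRingType) (G : ttgraph) (q : {poly K}) :
  Rel K G \Po q = \sum_(S : {set edge G} | connecting S) weight q (1 - q) S.
Proof.
rewrite /Rel raddf_sum; apply: eq_bigr => S _ /=.
by rewrite /weight rmorphM /= !rmorphXn /= rmorphB rmorph1 /= comp_polyX.
Qed.

Lemma Rel_weight (K : comNzRingType) (G : ttgraph) :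
  Rel K G = \sum_(S : {set edge G} | connecting S) weight 'X (1 - 'X) S.
Proof. by rewrite -comp_Rel comp_polyXr. Qed.

Lemma horner_Rel (K : comNzRingType) (G : ttgraph) (a : K) :
  (Rel K G).[a] = \sum_(S : {set edge G} | connecting S) weight a (1 - a) S.
Proof.
rewrite Rel_weight horner_sum; apply: eq_bigr => S _.
by rewrite /weight hornerM !horner_exp !hornerE.
Qed.

Lemma adj_in_sym (G : mgraph) (S : {set edge G}) : symmetric (adj_in S).
Proof.
by move=> x y; apply: eq_existsb => e; rewrite /joins orbC.
Qed.

Lemma connect_adj_in_sym (G : mgraph) (S : {set edge G}) :
  connect_sym (adj_in S).
Proof. exact/sym_connect_sym/adj_in_sym. Qed.

Lemma adj_in_ends (G : mgraph) (S : {set edge G}) e :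
  e \in S -> adj_in S (ends e).1 (ends e).2.
Proof.
by move=> eS; apply/existsP; exists e; rewrite eS /joins -surjective_pairing eqxx.
Qed.

Section Substitution.
Variables (G H : ttgraph) (o : edge G -> bool).

Let E := (edge G * edge H)%type.
Let slice (S : {set E}) (e : edge G) : {set edge H} := [set h | (e, h) \in S].
Let live (S : {set E}) : {set edge G} := [set e | connecting (slice S e)].

(** The ends of an edge that are glued to the source and to the target of H. *)
Let beg (e : edge G) := if o e then (ends e).2 else (ends e).1.
Let fin (e : edge G) := if o e then (ends e).1 else (ends e).2.

Lemma subst_embed_src e : subst_embed o e (src H) = inl (beg e).
Proof.
by rewrite /subst_embed /beg; case: (o e); case: (ends e) => x y; rewrite eqxx.
Qed.

Lemma subst_embed_tgt e : subst_embed o e (tgt H) = inl (fin e).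
Proof.
rewrite /subst_embed /fin eq_sym (negbTE (src_neq_tgt H)).
by case: (o e); case: (ends e) => x y; rewrite eqxx.
Qed.

Lemma subst_embed_inner e (i : inner H) : subst_embed o e (val i) = inr (e, i).
Proof.
rewrite /subst_embed; case: i => w /= p; case: (if o e then _ else _) => x y.
have := p; case/andP => /negbTE -> /negbTE ->.
by rewrite insubT; congr (inr (_, _)); apply: val_inj.
Qed.

Lemma joins_beg_fin e x y :
  joins e x y = ((beg e, fin e) == (x, y)) || ((beg e, fin e) == (y, x)).
Proof.
rewrite /joins /beg /fin; case: (ends e) => a b /=; case: (o e) => //=.
by rewrite !xpair_eqE orbC; congr (_ || _); rewrite andbC.
Qed.

Lemma adj_in_embed (S : {set E}) e w1 w2 :
  adj_in (slice S e) w1 w2 ->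
  adj_in (S : {set edge (subst_tt H o)}) (subst_embed o e w1) (subst_embed o e w2).
Proof.
case/existsP => h; rewrite inE => /andP[hS]; rewrite /joins => jw.
apply/existsP; exists (e, h); rewrite hS /joins /= /subst_ends /=.
by case/orP: jw => /eqP -> /=; rewrite eqxx ?orbT.
Qed.

Lemma connect_embed (S : {set E}) e w1 w2 :
  connect (adj_in (slice S e)) w1 w2 ->
  connect (adj_in (S : {set edge (subst_tt H o)}))
    (subst_embed o e w1) (subst_embed o e w2).
Proof.
case/connectP => p; elim: p w1 => [|w p IH] w1 /=; first by move=> _ ->.
case/andP => a pp lp; apply: connect_trans (connect1 (adj_in_embed a)) _.
exact: IH.
Qed.

Lemma live_connecting (S : {set E}) :
  connecting (live S) -> connecting (S : {set edge (subst_tt H o)}).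
Proof.
case/connectP => p; rewrite /connecting /=.
elim: p (src G) => [|y p IH] x /=; first by move=> _ ->.
case/andP => /existsP[e /andP[]]; rewrite inE => eS j pp lp.
apply: connect_trans (IH _ pp lp) => {IH pp lp}.
have := connect_embed eS; rewrite subst_embed_src subst_embed_tgt.
move: j; rewrite joins_beg_fin => /orP[] /eqP [-> ->] //.
by rewrite connect_adj_in_sym.
Qed.

(** Let C be the set of vertices of G reached from the source through edges whose
    copy of H connects its terminals.  A vertex in the copy of an edge e is
    marked when, inside that copy, it is connected to an end of e that lies in C.
    The mark is consistent at the two ends of e, because a copy connecting them
    puts both or neither in C, and it is preserved along the edges of S; so it
    spreads from the source to the target. *)
Lemma connecting_live (S : {set E}) :
  connecting (S : {set edge (subst_tt H o)}) -> connecting (live S).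
Proof.
pose C := connect (adj_in (live S)) (src G).
pose phi e w :=
  (connect (adj_in (slice S e)) w (src H) && C (beg e)) ||
  (connect (adj_in (slice S e)) w (tgt H) && C (fin e)).
have Cbf e : e \in live S -> C (beg e) = C (fin e).
  move=> eS; apply/idP/idP => Cx; apply: connect_trans Cx (connect1 _);
    apply/existsP; exists e; rewrite eS joins_beg_fin eqxx ?orbT //.
have phi_beg e : phi e (src H) = C (beg e).
  rewrite /phi connect0 /=; case: (boolP (C (beg e))) => // nC.
  by apply/negbTE/negP => /andP[c]; rewrite -Cbf ?inE // (negbTE nC).
have phi_fin e : phi e (tgt H) = C (fin e).
  rewrite /phi connect0 /= connect_adj_in_sym orbC; case: (boolP (C (fin e))) => // nC.
  by apply/negbTE/negP => /andP[c]; rewrite Cbf ?inE // (negbTE nC).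
pose psi (v : subst_vertex G H) :=
  match v with inl x => C x | inr (e, i) => phi e (val i) end.
have psiE e w : psi (subst_embed o e w) = phi e w.
  have [->|ws] := eqVneq w (src H); first by rewrite subst_embed_src phi_beg.
  have [->|wt] := eqVneq w (tgt H); first by rewrite subst_embed_tgt phi_fin.
  have p : (w != src H) && (w != tgt H) by rewrite ws wt.
  by rewrite -[w]/(val (Sub w p : inner H)) subst_embed_inner.
have phiS e w1 w2 : adj_in (slice S e) w1 w2 -> phi e w1 = phi e w2.
  move=> a; have cs := @connect_adj_in_sym H (slice S e).
  by rewrite /phi !(same_connect cs (connect1 a)).
have step (u v : vertex (subst_tt H o)) :
    adj_in (S : {set edge (subst_tt H o)}) u v -> psi u -> psi v.
  case/existsP => -[e h] /andP[hS].
  have a : adj_in (slice S e) (ends h).1 (ends h).2 by apply: adj_in_ends; rewrite inE.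
  have := phiS _ _ _ a; rewrite -!psiE /joins /= /subst_ends /=.
  by move=> eqv /orP[] /eqP[<- <-]; rewrite eqv.
have key p (u : vertex (subst_tt H o)) :
    path (adj_in (S : {set edge (subst_tt H o)})) u p -> psi u -> psi (last u p).
  elim: p u => [//|v p IH] u /= /andP[uv pp] pu; exact: IH pp (step _ _ uv pu).
case/connectP => p pp lp; have := key _ _ pp; rewrite -lp; apply.
by rewrite /= /C connect0.
Qed.

Lemma connecting_subst (S : {set E}) :
  connecting (S : {set edge (subst_tt H o)}) = connecting (live S).
Proof. by apply/idP/idP => [/connecting_live|/live_connecting]. Qed.

(** In Rel G evaluated at Rel H, the factor of an edge of G is the sum of the
    weights of the edge sets of H that connect its terminals, or that do not.
    Expanding the product of these sums gives one term for each choice of an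
    edge set in every copy of H, that is, for each edge set of the substituted
    graph. *)
Lemma Rel_subst (K : comNzRingType) :
  Rel K (subst_tt H o) = Rel K G \Po Rel K H.
Proof.
pose W := @weight {poly K} (edge H) 'X (1 - 'X).
have cR : 1 - Rel K H = \sum_(A | ~~ connecting A) W A.
  rewrite -(@sum_weight _ (edge H) ('X : {poly K})) (bigID (@connecting H)) /=.
  by rewrite Rel_weight [X in X - _]addrC addrK.
have RE (S : {set edge G}) e : (if e \in S then Rel K H else 1 - Rel K H) =
    \sum_(A : {set edge H} | connecting A == (e \in S)) W A.
  case: ifPn => _; rewrite ?cR ?Rel_weight; apply: eq_bigl => A.
    by rewrite eqb_id.
  by rewrite eqbF_neg.
pose lv (f : {ffun edge G -> {set edge H}}) : {set edge G} :=
  [set e | connecting (f e)]%SET.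
transitivity (\sum_(f : {ffun edge G -> {set edge H}} | connecting (lv f))
   \prod_e W (f e)); last first.
  rewrite comp_Rel; under [RHS]eq_bigr do rewrite weightE.
  under [RHS]eq_bigr => S _ do
    (under eq_bigr do rewrite RE; rewrite bigA_distr_big_dep).
  rewrite (partition_big lv (@connecting G)) //=; apply: eq_bigr => S cS.
  apply: eq_bigl => f; apply/andP/familyP => [[_ /eqP <- e]|fS].
    by rewrite unfold_in inE.
  have -> : lv f = S by apply/setP => e; rewrite inE; apply/eqP/fS.
  by rewrite eqxx.
pose toS (f : {ffun edge G -> {set edge H}}) : {set edge (subst_tt H o)} :=
  [set p : E | p.2 \in f p.1]%SET.
rewrite Rel_weight (reindex toS) /=; last first.
  exists (fun S : {set E} => [ffun e => slice S e]) => [f _|S _].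
    by apply/ffunP => e; rewrite ffunE; apply/setP => h; rewrite !inE.
  by apply/setP => -[e h]; rewrite !inE ffunE inE.
apply: eq_big => [f|f _].
  rewrite connecting_subst; congr connecting; apply/setP => e; rewrite !inE.
  by congr connecting; apply/setP => h; rewrite !inE.
rewrite weightE /W; under [RHS]eq_bigr do rewrite weightE.
by rewrite pair_bigA; apply: eq_bigr => -[e h] _; rewrite !inE.
Qed.

End Substitution.

Lemma Rel_iter_subst (K : comNzRingType) (G : ttgraph)
    (o : nat -> edge G -> bool) k (z : K) :
  (Rel K (iter_subst o k)).[z] = iter k.+1 (horner (Rel K G)) z.
Proof.
by elim: k z => [//|k IH] z /=; rewrite Rel_subst horner_comp IH.
Qed.

(** * Paths between the terminals and the shape of the reliability polynomial *)

Lemma joins_inj (G : mgraph) (e : edge G) x y a b :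
  joins e x y -> joins e a b -> (a == x) && (b == y) || (a == y) && (b == x).
Proof.
rewrite /joins => /orP[] /eqP -> /orP[] /eqP[-> ->]; by rewrite !eqxx ?orbT.
Qed.

Lemma walk_cat (G : mgraph) (x : vertex G) w1 w2 :
  walk x (w1 ++ w2) = walk x w1 && walk (last x (unzip2 w1)) w2.
Proof. by elim: w1 x => [|[e y] w1 IH] x //=; rewrite IH andbA. Qed.

Lemma walk_ends (G : mgraph) (x : vertex G) w f a b :
  walk x w -> f \in unzip1 w -> joins f a b ->
  (a \in x :: unzip2 w) && (b \in x :: unzip2 w).
Proof.
elim: w x => [//|[e y] w IH] x /= /andP[jxy ww].
rewrite inE => /orP[/eqP -> jab|fw jab]; last first.
  by have /andP[aw bw] := IH _ ww fw jab; rewrite inE aw orbT inE bw orbT.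
by case/orP: (joins_inj jxy jab) => /andP[/eqP -> /eqP ->];
  rewrite !inE !eqxx ?orbT.
Qed.

Lemma walk_connect (G : mgraph) (S : {set edge G}) (x : vertex G) w :
  walk x w -> {subset unzip1 w <= S} ->
  connect (adj_in S) x (last x (unzip2 w)).
Proof.
elim: w x => [//|[e y] w IH] x /= /andP[jxy ww] sub.
apply: connect_trans (connect1 _) (IH _ ww _) => [|f fw].
  by apply/existsP; exists e; rewrite jxy andbT sub // inE eqxx.
by apply: sub; rewrite inE fw orbT.
Qed.

Definition path_edges (G : mgraph) (w : seq (edge G * vertex G)) : {set edge G} :=
  [set e in unzip1 w]%SET.

Lemma path_edges_connecting (G : ttgraph) (w : seq (edge G * vertex G)) :
  st_path w -> connecting (path_edges w).
Proof.
case/and3P => ww /eqP lw _; rewrite /connecting -lw; apply: walk_connect => // e.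
by rewrite inE.
Qed.

(** If S misses an edge e of the path, the vertices that precede e on the path are
    closed under adjacency in S: the path edges after e have both ends after e,
    and no vertex occurs twice. *)
Lemma path_edges_minimal (G : ttgraph) (w : seq (edge G * vertex G)) S :
  st_path w -> connecting S -> S \subset path_edges w -> path_edges w \subset S.
Proof.
case/and3P => ww lw uw cS /fintype.subsetP Sw.
apply/fintype.subsetP => e; rewrite inE => ew.
apply/negPn/negP => eS.
case/mapP: ew => -[e' y] ew /= ee'; subst e'.
case/splitPr: ew => w1 w2 in ww lw uw Sw *.
rewrite walk_cat /= in ww; case/and3P: ww => ww1 jy ww2.
rewrite /unzip2 map_cat -/unzip2 -cat_cons cat_uniq /= in uw.
case/and3P: uw => _ nh _; have dis x :
    x \in y :: unzip2 w2 -> x \notin src G :: unzip2 w1 by apply: (hasPn _ _).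
have closed x z : adj_in S x z -> x \in src G :: unzip2 w1 -> z \in src G :: unzip2 w1.
  case/existsP => f /andP[fS j] xw1; have := Sw _ fS.
  rewrite inE /unzip1 map_cat mem_cat => /orP[fw1|].
    by have /andP[] := walk_ends ww1 fw1 j.
  rewrite inE => /orP[/eqP fe|fw2]; first by rewrite /= in fe; rewrite -fe fS in eS.
  have /andP[xw2 _] := walk_ends ww2 fw2 j.
  by have := dis _ xw2; rewrite xw1.
have : tgt G \in src G :: unzip2 w1.
  case/connectP: cS => p; have : src G \in src G :: unzip2 w1 by rewrite inE eqxx.
  elim: p {1 3 4}(src G) => [|v p IH] u uw /=; first by move=> _ ->.
  case/andP => uv; apply: IH; exact: closed uv uw.
apply/negP; rewrite -(eqP lw) /unzip2 map_cat last_cat /=.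
apply: dis; exact: mem_last.
Qed.

Lemma connecting_sub (G : ttgraph) (S S' : {set edge G}) :
  S \subset S' -> connecting S -> connecting S'.
Proof.
move=> /fintype.subsetP SS'; apply: connect_sub => x y /existsP[e /andP[eS j]].
by apply: connect1; apply/existsP; exists e; rewrite SS'.
Qed.

Lemma connect_first (T : finType) (e : rel T) x y :
  connect e x y -> x != y -> exists z, e x z.
Proof.
case/connectP => -[|z p] /=; first by move=> _ ->; rewrite eqxx.
by move=> /andP[xz _] _ _; exists z.
Qed.

Lemma connecting_ends (G : ttgraph) (S : {set edge G}) : connecting S ->
  exists f g a b, [/\ f \in S, g \in S, joins f (src G) a & joins g (tgt G) b].
Proof.
move=> cS; have [a /existsP[f /andP[fS ja]]] := connect_first cS (src_neq_tgt G).
move: cS; rewrite /connecting connect_adj_in_sym => cS.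
have ts : tgt G != src G by rewrite eq_sym src_neq_tgt.
have [b /existsP[g /andP[gS jb]]] := connect_first cS ts.
by exists f, g, a, b.
Qed.

Lemma connecting_card_gt0 (G : ttgraph) (S : {set edge G}) :
  connecting S -> (0 < #|S|)%N.
Proof.
by case/connecting_ends => f [_ [_ [_ [fS _ _ _]]]]; apply/card_gt0P; exists f.
Qed.

(** An edge of S at the source that is also an edge at the target would join the
    terminals. *)
Lemma connecting_card_gt1 (G : ttgraph) (S : {set edge G}) :
  ~~ adj (src G) (tgt G) -> connecting S -> (1 < #|S|)%N.
Proof.
move=> nadj /connecting_ends[f [g [a [b [fS gS ja jb]]]]].
apply/card_gt1P; exists f, g; split=> //; apply/eqP => fg; subst g.
have := joins_inj ja jb; rewrite [tgt G == _]eq_sym (negbTE (src_neq_tgt G)) /=.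
case/andP => /eqP ta _; case/negP: nadj; apply/existsP; exists f.
by rewrite inE ta.
Qed.

Section Values.
Variable G : ttgraph.

(** When k is the least size of a connecting set and K has characteristic 0, the
    constant coefficient of q is not 0: the reliability vanishes at 0 to order k. *)
Lemma Rel_lowest (K : comNzRingType) k :
  (forall S : {set edge G}, connecting S -> (k <= #|S|)%N) ->
  exists q : {poly K}, Rel K G = 'X^k * q /\
    q.[0] = #|[set S : {set edge G} | connecting S & #|S| == k]%SET|%:R.
Proof.
move=> kS.
exists (\sum_(S : {set edge G} | connecting S)
          'X^(#|S| - k) * (1 - 'X) ^+ (#|edge G| - #|S|)); split.
  rewrite Rel_weight mulr_sumr; apply: eq_bigr => S cS.
  by rewrite /weight mulrA -exprD subnKC // kS.
rewrite horner_sum -sum1_card natr_sum.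
under [RHS]eq_bigl do rewrite inE.
rewrite [RHS]big_mkcondr /=; apply: eq_bigr => S cS.
rewrite hornerM hornerXn horner_exp !hornerE subr0 expr1n mulr1 expr0n subn_eq0.
have -> : (#|S| <= k)%N = (#|S| == k) by rewrite eqn_leq kS // andbT.
by case: eqP.
Qed.

Lemma Rel0 (K : comNzRingType) : (Rel K G).[0] = 0.
Proof.
have [q [-> _]] := @Rel_lowest K 1 (fun S => @connecting_card_gt0 G S).
by rewrite expr1 hornerM hornerX mul0r.
Qed.

Lemma Rel1 (K : comNzRingType) : connected_graph G -> (Rel K G).[1] = 1.
Proof.
move=> cG; rewrite horner_Rel (bigD1 [set: edge G]%SET) /=; last exact: cG.
rewrite big1 => [|S /andP[_ ne]].
  by rewrite /weight cardsT subnn expr1n expr0 mulr1 addr0.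
rewrite /weight subrr expr0n subn_eq0 -cardsT.
by rewrite leqNgt proper_card ?mulr0 // properT.
Qed.

Lemma weight_gt0 (K : numDomainType) (I : finType) (a : K) (S : {set I}) :
  0 < a -> a < 1 -> 0 < weight a (1 - a) S.
Proof. by move=> a0 a1; rewrite mulr_gt0 ?exprn_gt0 ?subr_gt0. Qed.

Lemma Rel_le1 (K : numDomainType) (a : K) :
  0 < a -> a < 1 -> (Rel K G).[a] <= 1.
Proof.
move=> a0 a1; rewrite horner_Rel -[leRHS](@sum_weight _ (edge G) a).
rewrite [leRHS](bigID (@connecting G)) /= lerDl.
by apply: sumr_ge0 => S _; exact/ltW/weight_gt0.
Qed.

(** The sets containing an edge e0 between the terminals contribute a.  Another
    edge lies on a path avoiding e0, whose edge set adds a positive weight. *)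
Lemma Rel_gt_id (K : numDomainType) (a : K) :
  (2 <= #|edge G|)%N -> (forall e : edge G, on_st_path e) ->
  adj (src G) (tgt G) -> 0 < a -> a < 1 -> a < (Rel K G).[a].
Proof.
move=> m2 rel /existsP[e0 /andP[_ j0]] a0 a1.
have cadj (S : {set edge G}) : e0 \in S -> connecting S.
  by move=> e0S; apply: connect1; apply/existsP; exists e0; rewrite e0S.
have [e ne] : exists e, e != e0.
  have : (1 < #|[set: edge G]%SET|)%N by rewrite cardsT.
  case/card_gt1P => x [y [_ _ xy]]; have [xe|] := eqVneq x e0; last by exists x.
  by exists y; rewrite -xe eq_sym.
have [w pw ew] := rel e.
have e0w : e0 \notin path_edges w.
  apply/negP => e0w; have := @path_edges_minimal _ w [set e0]%SET pw.
  rewrite cadj ?finset.set11 // finset.sub1set e0w.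
  move=> /(_ isT isT)/fintype.subsetP/(_ e).
  by rewrite !inE ew (negbTE ne) => /(_ isT).
rewrite horner_Rel (bigID (fun S : {set edge G} => [set e0]%SET \subset S)) /=.
have -> : \sum_(S : {set edge G} | connecting S && ([set e0]%SET \subset S))
     weight a (1 - a) S = a.
  rewrite -[RHS]expr1 -(cards1 e0) -sum_weight_supset; apply: eq_bigl => S.
  by rewrite andbC andb_idr // finset.sub1set => /cadj.
rewrite ltrDl (bigD1 (path_edges w)) /=; last first.
  by rewrite path_edges_connecting // finset.sub1set.
apply: ltr_wpDr; last exact: weight_gt0.
by apply: sumr_ge0 => S _; exact/ltW/weight_gt0.
Qed.

(** Let P be a connecting set of least size; then D = #|P| by Rel_lowest.  At a = 1/2
    the sets containing P already contribute a ^+ D and all weights are positive,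
    so every connecting set contains P.  Paths being minimal, each of them has
    edge set exactly P; and every edge is on a path. *)
Lemma Rel_monomial_path (K : numFieldType) D :
  connected_graph G -> (0 < #|edge G|)%N -> (forall e : edge G, on_st_path e) ->
  Rel K G = 'X^D -> is_st_path G.
Proof.
move=> cG m0 rel RX.
have cT : connecting [set: edge G]%SET by exact: cG.
have [P cP Pmin] := arg_minnP (fun S : {set edge G} => #|S|) cT.
set c := #|P| in Pmin.
have [q [Rq q0]] := @Rel_lowest K c Pmin.
have {q0} q0 : q.[0] != 0.
  rewrite q0 pnatr_eq0 -lt0n; apply/card_gt0P; exists P.
  by rewrite inE cP eqxx.
have Dc : D = c.
  apply/eqP; rewrite eqn_leq; apply/andP; split; rewrite leqNgt; apply/negP => lt.
    move: Rq; rewrite RX -(subnKC (ltnW lt)) exprD => /mulfI.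
    rewrite expf_neq0 ?polyX_eq0 // => /(_ isT) qE.
    by move: q0; rewrite -qE hornerXn expr0n subn_eq0 leqNgt lt eqxx.
  move: Rq; rewrite RX -[X in _ = 'X^X * _](subnKC (ltnW lt)) exprD -mulrA.
  rewrite -[LHS]mulr1 => /mulfI.
  rewrite expf_neq0 ?polyX_eq0 // => /(_ isT)/(congr1 (fun p => p.[0])).
  rewrite hornerM hornerXn expr0n subn_eq0 leqNgt lt mul0r hornerE => /eqP.
  by rewrite oner_eq0.
pose a : K := 2^-1.
have a0 : 0 < a by rewrite invr_gt0 ltr0n.
have a1 : a < 1 by rewrite invf_lt1 ?ltr1n ?ltr0n.
have Psub S : connecting S -> P \subset S.
  move=> cS; apply/negPn/negP => PS.
  have := congr1 (fun p : {poly K} => p.[a]) RX.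
  rewrite hornerXn Dc -sum_weight_supset horner_Rel.
  rewrite (bigID (fun S : {set edge G} => P \subset S)) /=.
  rewrite [X in X + _](eq_bigl (fun S : {set edge G} => P \subset S)); last first.
    by move=> S'; rewrite andbC andb_idr // => /connecting_sub; exact.
  move/eqP; rewrite -subr_eq0 [X in X - _]addrC addrK psumr_eq0; last first.
    by move=> *; exact/ltW/weight_gt0.
  move/allP/(_ S); rewrite mem_index_enum cS PS => /(_ isT) /=.
  by rewrite gt_eqF ?weight_gt0.
have Pall e : e \in P.
  have [w pw ew] := rel e.
  have /fintype.subsetP := path_edges_minimal pw cP (Psub _ (path_edges_connecting pw)).
  by apply; rewrite inE.
have [e0 _] := card_gt0P m0.
have [w pw _] := rel e0.
have wall e : e \in unzip1 w.
  have /fintype.subsetP/(_ e (Pall e)) := Psub _ (path_edges_connecting pw).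
  by rewrite inE.
exists w; split=> // x.
have [y xy] : exists y, x != y.
  have [xs|] := eqVneq x (src G); last by exists (src G).
  by exists (tgt G); rewrite xs src_neq_tgt.
have [z /existsP[e /andP[_ j]]] := connect_first (cG x y) xy.
have /and3P[ww _ _] := pw.
by have /andP[] := walk_ends ww (wall e) j.
Qed.

Lemma Rel_morph (K L : comNzRingType) (f : {rmorphism K -> L}) (a : K) :
  (Rel L G).[f a] = f (Rel K G).[a].
Proof.
rewrite !horner_Rel rmorph_sum; apply: eq_bigr => S _.
by rewrite /weight rmorphM !rmorphXn rmorphB rmorph1.
Qed.

End Values.

(** * Moduli of complex numbers and products over roots of unity *)

Section Modulus.
Variable R : rcfType.
Implicit Types z w : R[i].

(** The norm of R[i] has its values in R[i]; this is the same number in R, where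
    the order is total. *)
Definition cabs z : R := complex.Re `|z|.

Lemma cabsE z : (cabs z)%:C%C = `|z|.
Proof. by rewrite /cabs normc_def. Qed.

Lemma cabsM z w : cabs (z * w) = cabs z * cabs w.
Proof. by apply: complexI; rewrite rmorphM /= !cabsE normrM. Qed.

Lemma cabsX z n : cabs (z ^+ n) = cabs z ^+ n.
Proof. by apply: complexI; rewrite rmorphXn /= !cabsE normrX. Qed.

Lemma cabsN z : cabs (- z) = cabs z.
Proof. by rewrite /cabs normrN. Qed.

Lemma cabsB z w : cabs (z - w) = cabs (w - z).
Proof. by rewrite -cabsN opprB. Qed.

Lemma cabs0 : cabs 0 = 0.
Proof. by rewrite /cabs normr0. Qed.

Lemma cabs1 : cabs 1 = 1.
Proof. by rewrite /cabs normr1. Qed.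

Lemma cabs_ge0 z : 0 <= cabs z.
Proof. by rewrite -ler0c cabsE. Qed.

Lemma cabs_eq0 z : (cabs z == 0) = (z == 0).
Proof. by rewrite -(inj_eq (@complexI _)) cabsE normr_eq0. Qed.

Lemma cabs_gt0 z : (0 < cabs z) = (z != 0).
Proof. by rewrite lt_def cabs_ge0 andbT cabs_eq0. Qed.

Lemma cabsD z w : cabs (z + w) <= cabs z + cabs w.
Proof. by rewrite -lecR rmorphD /= !cabsE ler_normD. Qed.

Lemma cabs_triangle u z w : cabs (z - w) <= cabs (z - u) + cabs (u - w).
Proof. by rewrite -{1}(subrK u z) -addrA cabsD. Qed.

Lemma cabs_sub z w : cabs z - cabs w <= cabs (z - w).
Proof. by rewrite lerBlDr -{1}(subrK w z) cabsD. Qed.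

Lemma cabs_real (x : R) : cabs x%:C%C = `|x|.
Proof. by rewrite /cabs normc_def /= expr0n addr0 sqrtr_sqr. Qed.

Lemma cabs_nat n : cabs n%:R = n%:R.
Proof. by rewrite -(rmorph_nat (real_complex R)) cabs_real normr_nat. Qed.

Lemma cabs_prod I (r : seq I) (P : pred I) (F : I -> R[i]) :
  cabs (\prod_(i <- r | P i) F i) = \prod_(i <- r | P i) cabs (F i).
Proof. exact: (big_morph _ cabsM cabs1). Qed.

Lemma cabs_sum I (r : seq I) (P : pred I) (F : I -> R[i]) :
  cabs (\sum_(i <- r | P i) F i) <= \sum_(i <- r | P i) cabs (F i).
Proof.
elim/big_rec2: _ => [|i y x _ h]; first by rewrite cabs0.
by apply: le_trans (cabsD _ _) _; rewrite lerD2l.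
Qed.

Lemma cabs_root1 z n : (0 < n)%N -> z ^+ n = 1 -> cabs z = 1.
Proof.
move=> n0 /(congr1 cabs); rewrite cabsX cabs1 => /eqP.
by rewrite pexpr_eq1 ?cabs_ge0 // => /eqP.
Qed.

Lemma prim_root_ex n : (0 < n)%N -> exists w : R[i], n.-primitive_root w.
Proof.
move=> n0; have [rs rsE] := closed_field_poly_normal ('X^n - 1 : {poly R[i]}).
rewrite lead_coefXnsubC // scale1r in rsE.
have : has n.-primitive_root rs.
  apply: has_prim_root => //.
  - apply/allP => x xrs; rewrite unity_rootE -subr_eq0.
    have : root ('X^n - 1) x by rewrite rsE root_prod_XsubC.
    by rewrite /root !hornerE.
  - rewrite -separable_prod_XsubC -rsE separable_Xn_sub_1 //.
    by rewrite pnatr_eq0 -lt0n.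
  have := congr1 (fun p : {poly _} => size p) rsE.
  by rewrite /= size_XnsubC // size_prod_XsubC => -[->].
by case/hasP => w _ pw; exists w.
Qed.

(** The homogeneous form of the factorization of X^n - 1. *)
Lemma prim_root_prod n (w x y : R[i]) : n.-primitive_root w ->
  \prod_(i < n) (x - y * w ^+ i) = x ^+ n - y ^+ n.
Proof.
move=> pw; have n0 := prim_order_gt0 pw.
have [->|y0] := eqVneq y 0.
  rewrite expr0n eqn0Ngt n0 subr0 (eq_bigr (fun=> x)) => [|i _].
    by rewrite prodr_const card_ord.
  by rewrite mul0r subr0.
have := congr1 (fun p => p.[x / y]) (factor_Xn_sub_1 pw).
rewrite horner_prod big_mkord !hornerE => e.
transitivity (\prod_(i < n) (y * (x / y - w ^+ i))).
  by apply: eq_bigr => i _; rewrite mulrBr mulrCA divff ?mulr1.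
rewrite big_split /= prodr_const card_ord.
under eq_bigr do rewrite -hornerXsubC.
rewrite e mulrBr mulr1 -exprMn mulrCA divff // mulr1 //.
Qed.

Lemma prim_root_sum n (w : R[i]) l : n.-primitive_root w ->
  \sum_(j < n) w ^+ (l * j) = if (n %| l)%N then n%:R else 0.
Proof.
move=> pw; case: ifPn => [dl|ndl].
  rewrite (eq_bigr (fun=> 1)) => [|j _].
    by rewrite sumr_const card_ord.
  by rewrite exprM (_ : w ^+ l = 1) ?expr1n //; apply/eqP; rewrite -(prim_order_dvd pw).
have w1 : w ^+ l - 1 != 0 by rewrite subr_eq0 -(prim_order_dvd pw).
apply: (mulfI w1); rewrite mulr0; under eq_bigr do rewrite exprM.
by rewrite -subrX1 -exprM mulnC exprM (prim_expr_order pw) expr1n subrr.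
Qed.

Lemma poly_factors (p : {poly R[i]}) : p != 0 ->
  exists rs : seq R[i], [/\ size rs = (size p).-1,
    forall b, (b \in rs) = root p b
    & forall z, p.[z] = lead_coef p * \prod_(b <- rs) (z - b)].
Proof.
move=> p0; have [rs rsE] := closed_field_poly_normal p.
have l0 : lead_coef p != 0 by rewrite lead_coef_eq0.
exists rs; split.
- by rewrite rsE size_scale // size_prod_XsubC.
- by move=> b; rewrite {1}rsE rootZ // root_prod_XsubC.
move=> z; rewrite {1}rsE hornerZ horner_prod; congr (_ * _).
by apply: eq_bigr => b _; rewrite hornerXsubC.
Qed.

Lemma prod_ge (I : eqType) (s : seq I) (F G : I -> R) :
  (forall i, i \in s -> 0 <= F i <= G i) ->
  \prod_(i <- s) F i <= \prod_(i <- s) G i.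
Proof. by move=> FG; rewrite big_seq [leRHS]big_seq; apply: ler_prod. Qed.

Lemma prod_seq_const (I : eqType) (s : seq I) (x : R) :
  \prod_(i <- s) x = x ^+ size s.
Proof. by rewrite big_const_seq count_predT -Monoid.iteropE. Qed.

(** A substitute for Harnack's inequality: every root b is at distance at least r
    from z0, so |z1 - b| <= 3 |z - b| on the half disc. *)
Lemma poly_harnack (p : {poly R[i]}) z0 r z z1 :
  0 < r -> (forall y, cabs (y - z0) < r -> p.[y] != 0) ->
  cabs (z - z0) <= r / 2 -> cabs (z1 - z0) <= r / 2 ->
  cabs p.[z1] <= 3 ^+ (size p).-1 * cabs p.[z].
Proof.
move=> r0 nz zr z1r.
have p0 : p != 0.
  by apply/eqP => p0; have := nz z0; rewrite subrr cabs0 p0 horner0 eqxx => /(_ r0).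
have [rs [<- rsE pE]] := poly_factors p0.
rewrite !pE !cabsM mulrCA ler_wpM2l ?cabs_ge0 // !cabs_prod.
rewrite -prod_seq_const -big_split /=; apply: prod_ge => b; rewrite rsE => rb.
have br : r <= cabs (b - z0).
  by rewrite leNgt; apply/negP => /nz; rewrite (eqP rb) eqxx.
rewrite cabs_ge0 /=.
have := cabs_triangle z0 z1 b; have := cabs_triangle z b z0.
rewrite (cabsB z0 b) (cabsB b z) => h1 h2.
lra.
Qed.

(** A substitute for the mean value property of log |p|: the factors of a root b at
    the k points multiply to |(z0 - b)^k - (- h)^k|, which differs from
    |z0 - b|^k by a factor at most 1 + 2^-k. *)
Lemma poly_circle (p : {poly R[i]}) z0 r h k w :
  0 < r -> (forall y, cabs (y - z0) < r -> p.[y] != 0) ->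
  cabs h <= r / 2 -> k.-primitive_root w ->
  \prod_(j < k) cabs p.[z0 + h * w ^+ j]
    <= cabs p.[z0] ^+ k * (1 + 2^-1 ^+ k) ^+ (size p).-1.
Proof.
move=> r0 nz hr pw; have k0 := prim_order_gt0 pw.
have p0 : p != 0.
  by apply/eqP => p0; have := nz z0; rewrite subrr cabs0 p0 horner0 eqxx => /(_ r0).
have [rs [<- rsE pE]] := poly_factors p0.
under eq_bigr do rewrite pE cabsM cabs_prod.
rewrite pE cabsM exprMn cabs_prod -mulrA big_split /= prodr_const card_ord.
rewrite ler_wpM2l ?exprn_ge0 ?cabs_ge0 // -prodrXl -prod_seq_const -big_split /=.
rewrite exchange_big /=; apply: prod_ge => b; rewrite rsE => rb.
rewrite prodr_ge0 => [|*]; last exact: cabs_ge0.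
have br : r <= cabs (z0 - b).
  by rewrite cabsB leNgt; apply/negP => /nz; rewrite (eqP rb) eqxx.
rewrite -cabs_prod.
have -> : \prod_(j < k) (z0 + h * w ^+ j - b) =
    (z0 - b) ^+ k - (- h) ^+ k.
  rewrite -(prim_root_prod _ _ pw); apply: eq_bigr => j _; ring.
apply: le_trans (cabsD _ _) _; rewrite cabsN !cabsX cabsN mulrDr mulr1 lerD2l.
by rewrite -exprMn lerXn2r ?nnegrE ?mulr_ge0 ?cabs_ge0 //; lra.
Qed.

End Modulus.

(** * Elementary estimates for complex polynomials *)

Section Estimates.
Variable R : rcfType.
Implicit Types (p q : {poly R[i]}) (z : R[i]).

(** The sum over the n-th roots of unity kills every power of h between 1 and
    n - 1. *)
Lemma poly_mean p z h n w : (size p <= n)%N -> n.-primitive_root w ->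
  \sum_(j < n) p.[z + h * w ^+ j] = n%:R * p.[z].
Proof.
move=> sn pw; pose q := p \Po ('X + z%:P).
have qE y : q.[y] = p.[z + y] by rewrite horner_comp !hornerE addrC.
have sq : (size q <= n)%N by rewrite size_comp_poly2 ?size_XaddC.
under eq_bigr do rewrite -qE (horner_coef_wide _ sq).
rewrite exchange_big /=; have n0 := prim_order_gt0 pw.
rewrite -[in RHS](addr0 z) -qE horner_coef0.
under eq_bigr => l _ do
  (under eq_bigr => j _ do rewrite exprMn -exprM (mulnC j) mulrA;
   rewrite -mulr_sumr (prim_root_sum _ pw)).
rewrite (bigD1 (Ordinal n0)) //= dvdn0 expr0 mulr1 mulrC big1 ?addr0 // => l.
rewrite -val_eqE /= => l0; rewrite gtnNdvd ?mulr0 ?lt0n //.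
Qed.

Lemma poly_max_principle p z rho M :
  (forall y, cabs (y - z) = rho -> cabs p.[y] <= M) -> 0 <= rho -> cabs p.[z] <= M.
Proof.
move=> pM rho0; have n0 : (0 < (size p).+1)%N by [].
have [w pw] := prim_root_ex R n0.
have e := poly_mean z rho%:C%C (leqnSn _) pw.
have := congr1 (@cabs R) e; rewrite cabsM cabs_nat => {}e.
have : (size p).+1%:R * cabs p.[z] <= (size p).+1%:R * M.
  rewrite -e; apply: le_trans (cabs_sum _ _ _) _.
  rewrite mulr_natl -[X in _ *+ X]card_ord -sumr_const; apply: ler_sum => j _.
  apply: pM; rewrite addrC addKr cabsM cabsX (cabs_root1 n0 (prim_expr_order pw)).
  by rewrite expr1n mulr1 cabs_real ger0_norm.
by rewrite ler_pM2l ?ltr0n.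
Qed.

(** A form of Schwarz's lemma: the maximum principle for the quotient
    (p - p(z)) / (X - z), on the circle of radius rho / 2 around y. *)
Lemma poly_lipschitz p z rho M : 0 < rho ->
  (forall y, cabs (y - z) <= rho -> cabs p.[y] <= M) ->
  forall y, cabs (y - z) <= rho / 4 ->
    cabs (p.[y] - p.[z]) <= 8 * M / rho * cabs (y - z).
Proof.
move=> rho0 pM y yz.
have /factor_theorem[g gE] : root (p - p.[z]%:P) z by rewrite /root !hornerE subrr.
have gy x : p.[x] - p.[z] = g.[x] * (x - z).
  by have := congr1 (fun p => p.[x]) gE; rewrite !hornerE.
rewrite gy cabsM ler_wpM2r ?cabs_ge0 //.
apply: (@poly_max_principle _ _ (rho / 2)); last by lra.
move=> x xy.
have h1 := cabs_triangle y x z; have h2 := cabs_triangle z x y.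
rewrite (cabsB z y) in h2.
have xz : cabs (x - z) <= rho by lra.
have xz4 : rho / 4 <= cabs (x - z) by lra.
have := congr1 (@cabs R) (gy x); rewrite cabsM => e.
have h3 := cabsD p.[x] (- p.[z]); rewrite cabsN in h3.
have := pM x xz; have : cabs p.[z] <= M by apply: pM; rewrite subrr cabs0 ltW.
move=> h4 h5; rewrite ler_pdivlMr //.
have h6 : cabs g.[x] * (rho / 4) <= cabs g.[x] * cabs (x - z).
  by rewrite ler_wpM2l ?cabs_ge0.
lra.
Qed.

Lemma poly_bounded p s : exists M, forall z, cabs z <= s -> cabs p.[z] <= M.
Proof.
exists (\sum_(i < size p) cabs p`_i * s ^+ i) => z zs.
rewrite horner_coef; apply: le_trans (cabs_sum _ _ _) _; apply: ler_sum => i _.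
rewrite cabsM cabsX ler_wpM2l ?cabs_ge0 // lerXn2r ?nnegrE ?cabs_ge0 //.
exact: le_trans (cabs_ge0 _) zs.
Qed.

Lemma poly_cont p z e : 0 < e ->
  exists2 d, 0 < d & forall y, cabs (y - z) < d -> cabs (p.[y] - p.[z]) < e.
Proof.
move=> e0; have [M pM] := poly_bounded p (cabs z + 1).
have pM' y : cabs (y - z) <= 1 -> cabs p.[y] <= `|M|.
  move=> yz; apply: le_trans (ler_norm M); apply: pM.
  have := cabs_sub y z; lra.
have L := poly_lipschitz ltr01 pM'.
have M0 : 0 < 8 * `|M| / 1 + 1 by rewrite divr1; have := normr_ge0 M; lra.
exists (Num.min (1/4) (e / (8 * `|M| / 1 + 1))).
  by rewrite lt_min divr_gt0 //= divr_gt0.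
move=> y; rewrite lt_min => /andP[y4 ye].
apply: le_lt_trans (L _ (ltW y4)) _; rewrite ltr_pdivlMr // in ye.
apply: le_lt_trans ye; rewrite mulrC ler_wpM2l ?cabs_ge0 //; lra.
Qed.

(** A quantitative open mapping property: if all roots of p - w were at distance at
    least e from z, then |p(z) - w| would be at least |lead_coef p| e^deg p. *)
Lemma poly_open p z e : (1 < size p)%N -> 0 < e ->
  exists2 d, 0 < d &
    forall w, cabs (p.[z] - w) < d -> exists2 y, cabs (y - z) < e & p.[y] = w.
Proof.
move=> sp e0; have p0 : p != 0 by rewrite -size_poly_gt0 ltnW.
exists (cabs (lead_coef p) * e ^+ (size p).-1).
  by rewrite mulr_gt0 ?exprn_gt0 // cabs_gt0 lead_coef_eq0.
move=> w pw.
have sw : (size (- w%:P) < size p)%N.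
  by rewrite size_polyN (leq_ltn_trans (size_polyC_leq1 _)).
have spw : size (p - w%:P) = size p by rewrite size_polyDl.
have lpw : lead_coef (p - w%:P) = lead_coef p by rewrite lead_coefDl.
have q0 : p - w%:P != 0 by rewrite -size_poly_gt0 spw ltnW.
have [rs [srs rsE pE]] := poly_factors q0.
have [/hasP[b brs bz]|/hasPn far] := boolP (has (fun b => cabs (b - z) < e) rs).
  exists b => //; move: brs; rewrite rsE /root !hornerE subr_eq0 => /eqP //.
move: pw; rewrite ltNge => /negP[].
have := pE z; rewrite !hornerE => ->; rewrite lpw cabsM ler_wpM2l ?cabs_ge0 //.
rewrite cabs_prod -spw -srs -prod_seq_const; apply: prod_ge => b /far.
by rewrite -leNgt cabsB (ltW e0).
Qed.

(** Once |z| is at least twice the modulus of every root b, |z - b| >= |z| / 2. *)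
Lemma poly_growth p : p != 0 ->
  exists c s, [/\ 0 < c, c <= 1 &
    forall z, s <= cabs z -> c * cabs z ^+ (size p).-1 <= cabs p.[z]].
Proof.
move=> p0; have [rs [srs rsE pE]] := poly_factors p0.
have l0 : 0 < cabs (lead_coef p) by rewrite cabs_gt0 lead_coef_eq0.
pose N := (size p).-1.
have h0 : 0 < cabs (lead_coef p) * 2^-1 ^+ N.
  by rewrite mulr_gt0 // exprn_gt0 // invr_gt0.
exists (Num.min 1 (cabs (lead_coef p) * 2^-1 ^+ N)).
exists (\sum_(b <- rs) 2 * cabs b).
split; [by rewrite lt_min ltr01|by rewrite ge_min lexx|].
move=> z sz; apply: (@le_trans _ _ (cabs (lead_coef p) * 2^-1 ^+ N * cabs z ^+ N)).
  by rewrite ler_wpM2r ?exprn_ge0 ?cabs_ge0 // ge_min lexx orbT.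
rewrite pE cabsM -mulrA ler_wpM2l ?cabs_ge0 // -exprMn cabs_prod.
rewrite /N -srs -prod_seq_const.
apply: prod_ge => b brs; rewrite mulr_ge0 ?invr_ge0 ?cabs_ge0 //=.
have bz : 2 * cabs b <= cabs z.
  apply: le_trans sz; rewrite (big_rem b) //= lerDl; apply: sumr_ge0 => b' _.
  by rewrite mulr_ge0 // cabs_ge0.
have := cabs_sub z b; lra.
Qed.

(** The polynomial p omits the m values a_i on the disc.  They are 2d apart, so p(z)
    can be d-close to only one of them, and for that one poly_harnack compares
    |p(z) - a_i| with its value at z1.  Thus prod_i |p(z) - a_i| is at least
    3^-N d^m on the half disc, where the exponent of 3 does not involve m.  This
    bound at k points of the circle through z1, the bound L^m at z1 itself and
    poly_circle for the upper bound together give the inequality. *)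
Lemma omitted_values_bound p (N m k : nat) (a : 'I_m -> R[i]) z0 z1 r d L B :
  0 < r -> 0 < d -> d <= 1 -> 1 <= L ->
  (forall i y, cabs (y - z0) < r -> p.[y] != a i) ->
  (forall i j, i != j -> 2 * d <= cabs (a i - a j)) ->
  cabs (z1 - z0) <= r / 2 ->
  (forall i, cabs (p.[z0] - a i) <= B) ->
  (forall i, L <= cabs (p.[z1] - a i)) ->
  (1 < size p)%N -> (size p).-1 = N ->
  L ^+ m * d ^+ (m * k) <=
    3 ^+ (N * k) * B ^+ (m * k.+1) * (1 + 2^-1 ^+ k.+1) ^+ (N * m).
Proof.
move=> r0 d0 d1 L1 om sep z1r pB pL sp sN.
have sq i : (size (- (a i)%:P) < size p)%N.
  by rewrite size_polyN (leq_ltn_trans (size_polyC_leq1 _)).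
have sqi i : (size (p - (a i)%:P)).-1 = N by rewrite size_polyDl.
have qi i y : (p - (a i)%:P).[y] = p.[y] - a i by rewrite !hornerE.
have qnz i y : cabs (y - z0) < r -> (p - (a i)%:P).[y] != 0.
  by move=> yr; rewrite qi subr_eq0 om.
have low z : cabs (z - z0) <= r / 2 ->
    3^-1 ^+ N * d ^+ m <= \prod_(i < m) cabs (p.[z] - a i).
  move=> zr.
  have d3 : 0 <= d ^+ m by rewrite exprn_ge0 // ltW.
  have [/existsP[i0 near]|/existsPn far] :=
    boolP [exists i, cabs (p.[z] - a i) < d]; last first.
    apply: (@le_trans _ _ (d ^+ m)).
      by rewrite ler_piMl // exprn_ile1 ?invr_ge0 // invf_le1 //; lra.
    rewrite -[X in _ ^+ X]card_ord -prodr_const; apply: ler_prod => i _.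
    by rewrite (ltW d0) leNgt far.
  rewrite (bigD1 i0) //= ler_pM ?exprn_ge0 ?invr_ge0 ?(ltW d0) //; first last.
    apply: (@le_trans _ _ (d ^+ m.-1)).
      have m0 := leq_ltn_trans (leq0n _) (ltn_ord i0).
      by rewrite -[X in d ^+ X](prednK m0) exprS ler_piMl ?exprn_ge0 ?(ltW d0).
    have -> : m.-1 = #|[pred i | i != i0]| by rewrite cardC1 card_ord.
    rewrite -prodr_const; apply: ler_prod => i; rewrite inE => ii.
    rewrite (ltW d0) /=; have := sep _ _ ii.
    have := cabs_triangle p.[z] (a i) (a i0).
    rewrite (cabsB (a i) p.[z]); lra.
  have := poly_harnack r0 (qnz i0) zr z1r; rewrite !qi sqi => h.
  rewrite exprVn -[leLHS]mulr1 ler_pdivrMl ?exprn_gt0 //.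
  exact: le_trans L1 (le_trans (pL i0) h).
have [w pw] := prim_root_ex R (ltn0Sn k).
pose zt j := z0 + (z1 - z0) * w ^+ j.
have circ i : \prod_(j < k.+1) cabs (p.[zt j] - a i) <=
    B ^+ k.+1 * (1 + 2^-1 ^+ k.+1) ^+ N.
  have := poly_circle r0 (qnz i) z1r pw; rewrite sqi.
  under eq_bigr do rewrite qi.
  move/le_trans; apply; rewrite ler_wpM2r ?exprn_ge0 ?addr_ge0 ?exprn_ge0 ?invr_ge0 //.
  by rewrite qi lerXn2r ?nnegrE ?cabs_ge0 //; apply: le_trans (pB i); rewrite cabs_ge0.
have ztr j : cabs (zt j - z0) <= r / 2.
  rewrite /zt addrC addKr cabsM cabsX (cabs_root1 _ (prim_expr_order pw)) //.
  by rewrite expr1n mulr1.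
have : \prod_(i < m) \prod_(j < k.+1) cabs (p.[zt j] - a i) <=
    (B ^+ k.+1 * (1 + 2^-1 ^+ k.+1) ^+ N) ^+ m.
  rewrite -[X in _ ^+ X]card_ord -prodr_const; apply: ler_prod => i _.
  by rewrite circ andbT prodr_ge0 // => *; exact: cabs_ge0.
rewrite exchange_big big_ord_recl /= => h.
have h0 : L ^+ m * (3^-1 ^+ N * d ^+ m) ^+ k <=
    \prod_(i < m) cabs (p.[zt 0] - a i) *
     \prod_(j < k) \prod_(i < m) cabs (p.[zt (bump 0 j)] - a i).
  apply: ler_pM; rewrite ?exprn_ge0 ?mulr_ge0 ?exprn_ge0 ?invr_ge0 ?(ltW d0) //.
  - by apply: le_trans L1.
  - rewrite -[X in _ ^+ X]card_ord -prodr_const; apply: ler_prod => i _.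
    rewrite /zt expr0 mulr1 (addrC z0) subrK pL andbT; exact: le_trans L1.
  rewrite -[X in _ ^+ X]card_ord -prodr_const; apply: ler_prod => j _.
  by rewrite low // mulr_ge0 ?exprn_ge0 ?invr_ge0 ?(ltW d0).
move: (le_trans h0 h).
rewrite !exprMn -!exprM [in X in _ <= X](mulnC _ m) (exprVn 3).
rewrite mulrCA ler_pdivrMl ?exprn_gt0 //; by rewrite mulrA.
Qed.

End Estimates.

Section Iterates.
Variable R : realType.
Variable T : {poly R[i]}.
Hypothesis T2 : (2 < size T)%N.
Implicit Types z : R[i].

Let D := (size T).-1.
Notation orb n z := (iter n (horner T) z).

Definition iterp n : {poly R[i]} := iter n (fun p => T \Po p) 'X.

Lemma iterpE n z : (iterp n).[z] = orb n z.
Proof. by elim: n => [|n IH] /=; rewrite ?hornerX // horner_comp IH. Qed.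

Lemma size_iterp n : (size (iterp n)).-1 = (D ^ n)%N.
Proof. by elim: n => [|n IH] /=; rewrite ?size_polyX // size_comp_poly IH expnS. Qed.

Lemma size_iterp_gt1 n : (1 < size (iterp n))%N.
Proof.
have : (0 < (size (iterp n)).-1)%N by rewrite size_iterp expn_gt0 /D; lia.
by case: (size _) => [|[]].
Qed.

Lemma T_neq0 : T != 0.
Proof. by rewrite -size_poly_gt0; case: size T2. Qed.

(** From c |z|^D <= |T(z)| and |z| >= 4 / c one gets 4 |z| <= |T(z)|, and then
    c |T^n(z)| >= 4^(D^n) by induction on n. *)
Lemma escape_radius : exists2 s, 1 <= s &
  forall z, s <= cabs z -> 2 * cabs z <= cabs T.[z] /\
    forall n, 4 ^+ (D ^ n) <= cabs (orb n z).
Proof.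
have [c [s [c0 c1 cs]]] := poly_growth T_neq0.
pose r := Num.max s (4 / c).
have r4 : 4 <= 4 / c by rewrite ler_pdivlMr //; lra.
have step z : r <= cabs z -> 4 * cabs z <= cabs T.[z] /\ c * cabs z ^+ D <= cabs T.[z].
  rewrite ge_max => /andP[sz zc]; split; last exact: cs.
  apply: le_trans (cs _ sz); rewrite -/D.
  have -> : D = (D - 2).+2 by rewrite /D; lia.
  have x1 : 1 <= cabs z by lra.
  rewrite ler_pdivrMr // in zc; apply: (@le_trans _ _ (cabs z * c * cabs z)).
    by rewrite ler_wpM2r ?cabs_ge0.
  rewrite !exprS (_ : c * _ = cabs z * c * cabs z * cabs z ^+ (D - 2)); last by ring.
  by rewrite ler_peMr ?exprn_ege1 // !mulr_ge0 ?cabs_ge0 // ltW.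
exists r; first by rewrite le_max (le_trans _ r4) ?orbT //; lra.
move=> z rz; split.
  by have [+ _] := step z rz; have := cabs_ge0 z; lra.
have stay n : r <= cabs (orb n z).
  elim: n => [//|n IH]; have [+ _] := step _ IH; have := cabs_ge0 (orb n z).
  by rewrite /=; lra.
move=> n; apply: (@le_trans _ _ (c^-1 * 4 ^+ (D ^ n))).
  by rewrite ler_peMl ?exprn_ge0 // invf_ge1.
elim: n => [|n IH].
  move: rz; rewrite ge_max expn0 expr1 mulrC => /andP[_ //].
have [_ /=] := step _ (stay n); apply: le_trans.
have h : (c^-1 * 4 ^+ (D ^ n)) ^+ D <= cabs (orb n z) ^+ D.
  by rewrite lerXn2r ?nnegrE ?mulr_ge0 ?invr_ge0 ?exprn_ge0 ?cabs_ge0 // ltW.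
apply: le_trans (ler_wpM2l (ltW c0) h).
rewrite exprMn -exprM -expnSr mulrA ler_wpM2r ?exprn_ge0 //.
have -> : D = (D - 2).+2 by rewrite /D; lia.
rewrite exprS mulrA divff ?gt_eqF // mul1r exprS ler_peMr ?invr_ge0 ?(ltW c0) //.
by rewrite exprn_ege1 // invf_ge1.
Qed.

End Iterates.

(** * Discs that miss the inverse orbit of 0 *)

Lemma finite_lower_bound (R : realFieldType) (I : finType) (f : I -> R) :
  (forall i, 0 < f i) -> exists2 d, 0 < d <= 1 & forall i, d <= f i.
Proof.
move=> f0; suff [d d01 df] : exists2 d, 0 < d <= 1 & forall i, i \in enum I -> d <= f i.
  by exists d => // i; rewrite df // mem_enum.
elim: (enum I) => [|i s [d /andP[d0 d1] ds]]; first by exists 1; rewrite ?ltr01 ?lexx.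
exists (Num.min d (f i)); first by rewrite lt_min d0 f0 ge_min d1.
by move=> j; rewrite inE ge_min => /orP[/eqP ->|/ds ->//]; rewrite lexx orbT.
Qed.

Lemma expr_ge_nat (R : realFieldType) n : (n%:R : R) <= 2 ^+ n.
Proof. by rewrite -natrX ler_nat ltnW // ltn_expl. Qed.

Lemma expr1D_le (R : realFieldType) (x : R) n : 0 <= x <= 1 ->
  (1 + x) ^+ n <= 1 + (2 ^+ n - 1) * x.
Proof.
move=> /andP[x0 x1]; elim: n => [|n IH]; first by rewrite !expr0 subrr mul0r addr0.
have y1 : 1 <= 2 ^+ n :> R by rewrite exprn_ege1 ?ler1n.
rewrite exprS; apply: (@le_trans _ _ ((1 + x) * (1 + (2 ^+ n - 1) * x))).
  by rewrite ler_wpM2l // addr_ge0.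
rewrite exprS; have : (2 ^+ n - 1) * (x * x) <= (2 ^+ n - 1) * x.
  by rewrite ler_wpM2l ?subr_ge0 // ler_piMl.
move: (2 ^+ n) => y; lra.
Qed.

Lemma poly_preimage (R : rcfType) (p : {poly R[i]}) w :
  (1 < size p)%N -> exists z, p.[z] = w.
Proof.
move=> sp; have sq : size (p - w%:P) != 1.
  rewrite size_polyDl ?size_polyN ?(leq_ltn_trans (size_polyC_leq1 _)) //.
  by rewrite neq_ltn sp orbT.
have [z] := closed_rootP _ sq; rewrite /root !hornerE subr_eq0 => /eqP zw.
by exists z.
Qed.

Section OmittedOrbit.
Variable R : realType.
Variable T : {poly R[i]}.
Hypothesis T2 : (2 < size T)%N.
Hypothesis T0 : T.[0] = 0.
Variable a0 : R[i].
Hypothesis a0_neq0 : a0 != 0.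
Hypothesis Ta0 : T.[a0] = 0.

Notation orb n z := (iter n (horner T) z).
Let D := (size T).-1.

Lemma orb0 n : orb n 0 = 0.
Proof. by elim: n => //= n ->. Qed.

(** A chain of preimages starting at a0: its i-th member needs exactly i + 1 steps to
    reach 0, so the chain does not repeat. *)
Lemma preimages_of_zero : exists a : nat -> R[i],
  injective a /\ forall i, orb i.+1 (a i) = 0.
Proof.
have pre w : exists z, T.[z] == w.
  by have [z zw] := poly_preimage w (ltnW T2); exists z; rewrite zw.
pose a i := iter i (fun w => xchoose (pre w)) a0.
have aS i : T.[a i.+1] = a i by apply/eqP/(xchooseP (pre (a i))).
have aE i : orb i (a i) = a0 by elim: i => [//|i IH]; rewrite iterSr aS.
have aE1 i : orb i.+1 (a i) = 0 by rewrite /= aE.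
have lt i j : (i < j)%N -> a i <> a j.
  move=> ij aij; have := aE j; rewrite -aij -(subnK ij) iterD aE1 orb0 => a00.
  by move: a0_neq0; rewrite a00 eqxx.
exists a; split; last exact: aE1.
move=> i j aij; have [/lt//|/lt h|//] := ltngtP i j.
by case: h.
Qed.

(** If z1 escaped, entering the region of superexponential growth at time n0, then
    omitted_values_bound could be applied to the iterates of order n + n0.  Their
    degree is N E with N = D^n and E = D^n0, their values at z1 exceed 2^N, and
    those at z0 stay bounded.  The number of circle points is k + 1 = E + 1 as
    (1 + 2^-(E+1))^E <= 3/2; next m is chosen so large that (4/3)^m >= 2 * 3^(E E),
    which leaves a factor 2^N on the left against a constant; n is chosen last. *)
Lemma orbit_stays_bounded z0 B0 r z1 s :
  (forall z, s <= cabs z -> forall n, 4 ^+ (D ^ n) <= cabs (orb n z)) ->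
  (forall n, cabs (orb n z0) <= B0) -> 0 < r ->
  (forall n y, cabs (y - z0) < r -> orb n y != 0) ->
  cabs (z1 - z0) <= r / 2 -> forall n, cabs (orb n z1) < s.
Proof.
move=> esc z0B r0 om z1r n0; rewrite ltNge; apply/negP => far.
have [a [a_inj aE]] := preimages_of_zero.
have D2 : (1 < D)%N by rewrite /D; lia.
pose E := (D ^ n0)%N.
have [m mE] : exists m, 2 * 3 ^+ (E * E) <= (4 / 3) ^+ m :> R.
  pose X : R := 2 * 3 ^+ (E * E).
  have X0 : 0 <= X by rewrite mulr_ge0 ?exprn_ge0.
  exists (3 * Num.bound X)%N; rewrite -/X exprM.
  apply: le_trans (ltW (archi_boundP X0)) _; apply: le_trans (expr_ge_nat R _) _.
  by rewrite lerXn2r ?nnegrE ?exprn_ge0 ?divr_ge0 //; rewrite !exprS expr0; lra.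
have [d /andP[d0 d1] sep] : exists2 d, 0 < d <= 1 &
    forall i j : 'I_m, i != j -> 2 * d <= cabs (a i - a j).
  pose f (p : 'I_m * 'I_m) := if p.1 == p.2 then 1 else cabs (a p.1 - a p.2) / 2.
  have [|d d01 df] := @finite_lower_bound R ('I_m * 'I_m)%type f.
    move=> -[i j]; rewrite /f /=; case: eqVneq => // ij.
    rewrite divr_gt0 // cabs_gt0 subr_eq0; apply: contra ij => /eqP/a_inj ij.
    exact/eqP/val_inj.
  exists d => // i j ij; have := df (i, j); rewrite /f /= (negbTE ij); lra.
pose A := \sum_(i < m) cabs (a i).
have A0 : 0 <= A by apply: sumr_ge0 => i _; exact: cabs_ge0.
have aA (i : 'I_m) : cabs (a i) <= A.
  by rewrite /A (bigD1 i) //= lerDl; apply: sumr_ge0 => j _; exact: cabs_ge0.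
pose B := B0 + A.
have B00 : 0 <= B0 by apply: le_trans (z0B 0%N); exact: cabs_ge0.
pose C := B ^+ (m * E.+1) / d ^+ (m * E).
have C0 : 0 <= C by rewrite divr_ge0 ?exprn_ge0 ?addr_ge0 // ltW.
pose n := (Num.bound C + Num.bound A)%N.
pose N := (D ^ n)%N.
have nN : (n < N)%N by rewrite ltn_expl.
have big (x : R) : 0 <= x -> (Num.bound x <= n)%N -> x < 2 ^+ N.
  move=> x0 xn; apply: lt_le_trans (archi_boundP x0) _.
  apply: le_trans (expr_ge_nat R _) _; rewrite ler_weXn2l ?ler1n //.
  exact: leq_trans xn (ltnW nN).
have CN : C < 2 ^+ N by apply: big => //; rewrite leq_addr.
have AN : A < 2 ^+ N by apply: big => //; rewrite leq_addl.
have L1 : 1 <= 2 ^+ N :> R by rewrite exprn_ege1 ?ler1n.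
have main : (2 ^+ N) ^+ m * d ^+ (m * E) <= 3 ^+ (N * E * E) * B ^+ (m * E.+1) *
    (1 + 2^-1 ^+ E.+1) ^+ (N * E * m).
  apply: (@omitted_values_bound R (iterp T (n + n0)) (N * E) m E
    (fun i => a i) z0 z1 r d (2 ^+ N) B r0 d0 d1 L1) => //.
  - move=> i y yr; rewrite iterpE; apply/eqP => e.
    by have := om (i.+1 + (n + n0))%N y yr; rewrite iterD e aE eqxx.
  - move=> i; rewrite iterpE /B; apply: le_trans (cabsD _ _) _; rewrite cabsN.
    by rewrite lerD.
  - move=> i; rewrite iterpE iterD; have := esc _ far n; rewrite -/N.
    have := cabs_sub (orb n (orb n0 z1)) (a i); have := aA i.
    have -> : 4 ^+ N = 2 ^+ N * 2 ^+ N :> R by rewrite -exprMn -natrM.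
    have N1 : 2 <= 2 ^+ N :> R.
      by rewrite -[leLHS]expr1 ler_weXn2l ?ler1n // (leq_ltn_trans _ nN).
    move: AN N1; move: (2 ^+ N) => x *; nra.
  - exact: size_iterp_gt1.
  - by rewrite size_iterp expnD.
have eE : (1 + 2^-1 ^+ E.+1) ^+ E <= 3 / 2 :> R.
  have := @expr1D_le R (2^-1 ^+ E.+1) E.
  rewrite exprn_ge0 ?invr_ge0 // exprn_ile1 ?invr_ge0 ?invf_le1 ?ler1n //.
  move=> /(_ isT)/le_trans; apply.
  rewrite mulrBl exprS mulrCA exprVn divff ?expf_neq0 // mul1r.
  have : 0 <= 2 ^- E :> R by rewrite invr_ge0 exprn_ge0.
  lra.
have {main} : (2 ^+ N) ^+ m * d ^+ (m * E) <=
    (3 ^+ (E * E)) ^+ N * B ^+ (m * E.+1) * ((3 / 2) ^+ m) ^+ N.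
  apply: le_trans main _.
  rewrite -(mulnA N) (mulnC N) (exprM 3) ler_wpM2l //.
    by rewrite mulr_ge0 ?exprn_ge0 ?addr_ge0.
  rewrite -(mulnA N E m) (mulnC N) !exprM.
  rewrite lerXn2r ?nnegrE ?exprn_ge0 ?addr_ge0 ?exprn_ge0 ?invr_ge0 ?divr_ge0 //.
  by rewrite lerXn2r ?nnegrE ?exprn_ge0 ?addr_ge0 ?exprn_ge0 ?invr_ge0 ?divr_ge0.
apply/negP; rewrite -ltNge.
have low : 2 ^+ N * (3 ^+ (E * E)) ^+ N * ((3 / 2) ^+ m) ^+ N <= (2 ^+ N) ^+ m :> R.
  rewrite (exprAC 2) -!exprMn lerXn2r ?nnegrE ?exprn_ge0 //.
  have -> : 2 ^+ m = (4 / 3) ^+ m * (3 / 2) ^+ m :> R.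
    by rewrite -exprMn; congr (_ ^+ _); lra.
  by rewrite ler_wpM2r ?exprn_ge0 ?divr_ge0.
have dE : 0 < d ^+ (m * E) by rewrite exprn_gt0.
apply: lt_le_trans (ler_wpM2r (ltW dE) low).
rewrite /C ltr_pdivrMr // in CN.
set u := (3 ^+ _) ^+ N; set v := (_ ^+ m) ^+ N.
have uv : 0 < u * v by rewrite /u /v !(mulr_gt0, exprn_gt0) ?divr_gt0.
rewrite (_ : u * _ * v = (u * v) * B ^+ (m * E.+1)); last by ring.
rewrite (_ : 2 ^+ N * u * v * _ = (u * v) * (2 ^+ N * d ^+ (m * E))); last by ring.
by rewrite ltr_pM2l.
Qed.

End OmittedOrbit.

(** * The sphere and its metric *)

Section Sphere.
Variable R : realType.
Implicit Types (z w : R[i]) (a b c : riemann_sphere R) (e d : R).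

Definition near_on_sphere a e b := ball (stereo a) e (stereo b).

Lemma near_on_sphereE a e b : near_on_sphere a e b <->
  [/\ `|(stereo a).1.1 - (stereo b).1.1| < e,
      `|(stereo a).1.2 - (stereo b).1.2| < e &
      `|(stereo a).2 - (stereo b).2| < e].
Proof. by split=> [[[]]|[]] *; do ?split. Qed.

Lemma nbhs_sphere a (B : set (riemann_sphere R)) :
  nbhs a B <-> exists2 e, 0 < e & forall b, near_on_sphere a e b -> B b.
Proof.
split=> [/nbhs_ballP[e /= e0 aB]|[e e0 aB]]; first by exists e => // b; exact: aB.
by apply/nbhs_ballP; exists e.
Qed.

Lemma cabs_sqr z : cabs z ^+ 2 = complex.Re z ^+ 2 + complex.Im z ^+ 2.
Proof. by apply: complexI; rewrite rmorphXn /= cabsE add_Re2_Im2. Qed.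

(** The classical formula for the chordal distance of z and w, squared. *)
Lemma stereo_chord z w :
  ((stereo (Some z)).1.1 - (stereo (Some w)).1.1) ^+ 2 +
  ((stereo (Some z)).1.2 - (stereo (Some w)).1.2) ^+ 2 +
  ((stereo (Some z)).2 - (stereo (Some w)).2) ^+ 2 =
  4 * cabs (z - w) ^+ 2 / ((cabs z ^+ 2 + 1) * (cabs w ^+ 2 + 1)).
Proof.
rewrite !cabs_sqr /stereo; case: z => x y; case: w => u v /=.
field.
by apply/andP; split; apply: lt0r_neq0; rewrite ltr_wpDl // addr_ge0 ?sqr_ge0.
Qed.

Lemma stereo_third z : (stereo (Some z)).2 = 1 - 2 / (cabs z ^+ 2 + 1).
Proof.
rewrite cabs_sqr /stereo; case: z => x y /=; field.
by apply: lt0r_neq0; rewrite ltr_wpDl // addr_ge0 ?sqr_ge0.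
Qed.

Lemma stereo_on_sphere a :
  (stereo a).1.1 ^+ 2 + (stereo a).1.2 ^+ 2 + (stereo a).2 ^+ 2 = 1.
Proof.
case: a => [[x y]|] /=; last by rewrite expr0n expr1n !add0r.
field.
by apply: lt0r_neq0; rewrite ltr_wpDl // addr_ge0 ?sqr_ge0.
Qed.

Lemma sqr_lt_norm (x e : R) : 0 <= e -> x ^+ 2 < e ^+ 2 -> `|x| < e.
Proof. by move=> e0; rewrite -[x ^+ 2]real_normK ?num_real // ltr_pXn2r ?nnegrE. Qed.

Lemma near_of_dist z w e : cabs (z - w) < e / 2 ->
  near_on_sphere (Some z) e (Some w).
Proof.
move=> zw; have e0 : 0 <= e by have := cabs_ge0 (z - w); lra.
have := stereo_chord z w; set s := _ / _ => ch.
have se : s < e ^+ 2.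
  have s4 : s <= 4 * cabs (z - w) ^+ 2.
    have h0 : 1 <= cabs z ^+ 2 + 1 by rewrite lerDr sqr_ge0.
    have h1 : 1 <= cabs w ^+ 2 + 1 by rewrite lerDr sqr_ge0.
    rewrite /s ler_pdivrMr; last by apply: mulr_gt0; apply: lt_le_trans ltr01 _.
    have h2 : 1 <= (cabs z ^+ 2 + 1) * (cabs w ^+ 2 + 1).
      by have := ler_pM ler01 ler01 h0 h1; rewrite mulr1.
    by rewrite ler_peMr // mulr_ge0 ?sqr_ge0.
  apply: le_lt_trans s4 _; have := cabs_ge0 (z - w); nra.
apply/near_on_sphereE; split; apply: sqr_lt_norm => //;
  apply: le_lt_trans se; rewrite -ch.
- by rewrite -addrA lerDl addr_ge0 ?sqr_ge0.
- by rewrite addrAC lerDr addr_ge0 ?sqr_ge0.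
- by rewrite lerDr addr_ge0 ?sqr_ge0.
Qed.

(** The third coordinate of stereo w, which is 1 - 2 / (|w|^2 + 1), first bounds |w|;
    then stereo_chord bounds |w - z|. *)
Lemma dist_of_near z e : 0 < e -> exists2 d, 0 < d &
  forall b, near_on_sphere (Some z) d b -> exists2 w, b = Some w & cabs (w - z) < e.
Proof.
move=> e0; pose n := cabs z ^+ 2 + 1.
have n1 : 1 <= n by rewrite lerDr sqr_ge0.
have n0 : 0 < n by lra.
exists (Num.min (1 / n) (e / (2 * n))); first by rewrite lt_min !divr_gt0 // mulr_gt0.
move=> b /near_on_sphereE [b1 b2 b3].
case: b b1 b2 b3 => [w|]; last first.
  rewrite stereo_third /= -/n => _ _; rewrite lt_min => /andP[+ _].
  rewrite addrAC subrr sub0r normrN gtr0_norm ?divr_gt0 // ltr_pM2r ?invr_gt0 //; lra.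
move=> b1 b2 b3; exists w => //.
pose m := cabs w ^+ 2 + 1.
have m1 : 1 <= m by rewrite lerDr sqr_ge0.
have m0 : 0 < m by lra.
have mn : m <= 2 * n.
  move: b3; rewrite !stereo_third -/n -/m lt_min => /andP[+ _].
  have -> : 1 - 2 / n - (1 - 2 / m) = 2 * m^-1 - 2 * n^-1 by ring.
  rewrite ltr_norml mul1r => /andP[h _].
  have h2 : n^-1 < 2 * m^-1 by lra.
  rewrite -(ltr_pM2r m0) -mulrA mulVf ?gt_eqF // mulr1 in h2.
  rewrite -(ltr_pM2l n0) mulrA divff ?gt_eqF // mul1r in h2.
  lra.
set d := Num.min _ _ in b1 b2 b3.
have d0 : 0 < d by rewrite lt_min !divr_gt0 // mulr_gt0.
have sq x : `|x| < d -> x ^+ 2 < d ^+ 2.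
  by move=> xd; rewrite -[x ^+ 2]real_normK ?num_real // ltr_pXn2r ?nnegrE // ltW.
have := stereo_chord z w; rewrite -/n -/m => ch.
have chd : 4 * cabs (z - w) ^+ 2 / (n * m) < 3 * d ^+ 2.
  by rewrite -ch; have := sq _ b1; have := sq _ b2; have := sq _ b3; lra.
rewrite ltr_pdivrMr ?mulr_gt0 // in chd.
have dn : d * (2 * n) <= e.
  by rewrite -ler_pdivlMr ?mulr_gt0 // ge_min lexx orbT.
have dn2 : (d * (2 * n)) ^+ 2 <= e ^+ 2.
  by rewrite ler_pXn2r ?nnegrE // ?mulr_ge0 // ltW.
have d20 : 0 <= d ^+ 2 by rewrite sqr_ge0.
have nm : d ^+ 2 * (n * m) <= d ^+ 2 * (n * (2 * n)).
  by rewrite !ler_wpM2l // ltW.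
rewrite cabsB -(ltr_pXn2r (_ : 0 < 2)%N) ?nnegrE ?cabs_ge0 ?ltW //.
rewrite exprMn in dn2.
have : 0 <= d ^+ 2 * (n * n) by rewrite !mulr_ge0 // ltW.
rewrite exprMn in dn2; move: dn2 nm chd; rewrite !expr2 => *; lra.
Qed.

Lemma near_infinity e : 0 < e -> exists M, forall z, M <= cabs z ->
  near_on_sphere None e (Some z).
Proof.
move=> e0; exists (Num.max 1 (Num.max (3 / e) (5 / e ^+ 2))) => z.
rewrite !ge_max => /and3P[z1 ze ze2].
pose n := cabs z ^+ 2 + 1; have n0 : 0 < n by rewrite ltr_wpDl ?sqr_ge0.
have t : (stereo (Some z)).2 = 1 - 2 / n by rewrite stereo_third.
have e20 : 0 < e ^+ 2 by rewrite exprn_gt0.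
rewrite ler_pdivrMr // in ze2; rewrite ler_pdivrMr // in ze.
have nz : cabs z <= n by rewrite /n; nra.
have nze : cabs z * e <= n * e by rewrite ler_wpM2r // ltW.
have nze2 : cabs z * e ^+ 2 <= n * e ^+ 2 by rewrite ler_wpM2r // ltW.
have n2 : 2 / n < e by rewrite ltr_pdivrMr //; lra.
have n4 : 4 / n < e ^+ 2 by rewrite ltr_pdivrMr //; lra.
have sph := stereo_on_sphere (Some z).
have h : (stereo (Some z)).1.1 ^+ 2 + (stereo (Some z)).1.2 ^+ 2 < e ^+ 2.
  have -> : (stereo (Some z)).1.1 ^+ 2 + (stereo (Some z)).1.2 ^+ 2 =
      1 - (1 - 2 / n) ^+ 2.
    by rewrite -t; lra.
  have := sqr_ge0 (2 / n); nra.
apply/near_on_sphereE; rewrite t /= !sub0r !normrN; split.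
- by apply: sqr_lt_norm (ltW e0) _; apply: le_lt_trans h; rewrite lerDl sqr_ge0.
- by apply: sqr_lt_norm (ltW e0) _; apply: le_lt_trans h; rewrite lerDr sqr_ge0.
by rewrite opprB addrC subrK ger0_norm // divr_ge0 // ltW.
Qed.

Lemma far_of_near (M : R) : exists2 d, 0 < d &
  forall z, near_on_sphere None d (Some z) -> M < cabs z.
Proof.
pose n := M ^+ 2 + 1; have n0 : 0 < n by rewrite ltr_wpDl ?sqr_ge0.
exists (2 / n); first by rewrite divr_gt0.
move=> z /near_on_sphereE[_ _]; rewrite stereo_third /= opprB addrC subrK.
have m0 : 0 < cabs z ^+ 2 + 1 by rewrite ltr_wpDl ?sqr_ge0.
rewrite ger0_norm ?divr_ge0 ?(ltW m0) // ltr_pM2l // ltf_pV2 ?posrE // /n => h.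
have h2 : `|M| ^+ 2 < cabs z ^+ 2 by rewrite real_normK ?num_real //; lra.
apply: le_lt_trans (ler_norm M) _.
by rewrite -(ltr_pXn2r (_ : 0 < 2)%N) ?nnegrE ?cabs_ge0.
Qed.

End Sphere.

(** * Points of the Fatou set *)

Section FatouSets.
Variable R : realType.
Implicit Types (z w : R[i]) (a b c : riemann_sphere R) (e d : R).
Notation near_on := (@near_on_sphere R).

(** Pointwise equicontinuity of the iterates, stated through the metric of the
    ambient space of the sphere. *)
Definition equicontinuous_at (f : riemann_sphere R -> riemann_sphere R) a :=
  forall e, 0 < e -> exists2 d, 0 < d &
    forall b, near_on a d b -> forall n, near_on (iter n f a) e (iter n f b).

Lemma equicontinuous_atP f a : equicontinuous_at f a <->
  forall E : set (riemann_sphere R * riemann_sphere R), entourage E ->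
    \forall b \near a, forall n, [set: nat] n -> E (iter n f a, iter n f b).
Proof.
split=> [eq E|eq e e0].
  rewrite -entourage_ballE => -[e /= e0 eE].
  have [d d0 ad] := eq e e0.
  by apply/nbhs_sphere; exists d => // b /ad ab n _; apply: eE; exact: ab.
have [] := (nbhs_sphere a _).1 (eq _ (entourage_ball (riemann_sphere R) (PosNum e0))).
by move=> d d0 ad; exists d => // b /ad ab n; exact: ab.
Qed.

Lemma Fatou_interior f : Fatou f = [set a | equicontinuous_at f a]°.
Proof.
apply/seteqP; split=> [a [U [oU eU] Ua]|a ia].
  rewrite /interior /= nbhsE; exists U => // b Ub.
  by apply/equicontinuous_atP => E; apply: eU; rewrite inE.
exists [set a | equicontinuous_at f a]° => //; split; first exact: open_interior.
move=> b; rewrite inE => /interior_subset eb E.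
exact: (equicontinuous_atP f b).1.
Qed.

Lemma FatouP f a : Fatou f a <-> exists2 e, 0 < e &
  forall b, near_on a e b -> equicontinuous_at f b.
Proof. by rewrite Fatou_interior; exact: nbhs_sphere. Qed.

Variable T : {poly R[i]}.
Hypothesis T2 : (2 < size T)%N.
Notation orb n z := (iter n (horner T) z).
Let D := (size T).-1.

Lemma iter_sphere_map n z : iter n (sphere_map T) (Some z) = Some (orb n z).
Proof. by elim: n => //= n ->. Qed.

Lemma iter_sphere_map_infinity n : iter n (sphere_map T) None = None.
Proof. by elim: n => //= n -> /=; rewrite leqNgt (ltn_trans _ T2). Qed.

Lemma orbit_cont n z e : 0 < e -> exists2 d, 0 < d &
  forall y, cabs (y - z) < d -> cabs (orb n y - orb n z) < e.
Proof.
move=> e0; have [d d0 dP] := poly_cont (iterp T n) z e0.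
by exists d => // y /dP; rewrite !iterpE.
Qed.

Lemma orbit_cont_upto n z e : 0 < e -> exists2 d, 0 < d &
  forall y, cabs (y - z) < d -> forall k, (k < n)%N -> cabs (orb k y - orb k z) < e.
Proof.
move=> e0; elim: n => [|n [d d0 dP]]; first by exists 1.
have [d' d'0 d'P] := orbit_cont n z e0.
exists (Num.min d d'); first by rewrite lt_min d0.
move=> y; rewrite lt_min => /andP[yd yd'] k; rewrite ltnS leq_eqVlt.
by move=> /orP[/eqP ->|]; [exact: d'P|exact: dP].
Qed.

(** Uniformly bounded polynomials are uniformly Lipschitz on a smaller disc. *)
Lemma bounded_Fatou z r M : 0 < r ->
  (forall y, cabs (y - z) < r -> forall n, cabs (orb n y) <= M) ->
  Fatou (sphere_map T) (Some z).
Proof.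
move=> r0 bd; apply/FatouP.
have M0 : 0 <= M by apply: le_trans (bd z _ 0%N); rewrite ?subrr ?cabs0 ?cabs_ge0.
have [d d0 dP] := dist_of_near z (divr_gt0 r0 (ltr0n R 2)).
exists d => // b /dP[w -> wz] e e0.
pose rho := r / 4; have rho0 : 0 < rho by rewrite divr_gt0.
pose L := 8 * M / rho; have L0 : 0 <= L by rewrite !mulr_ge0 // invr_ge0 ltW.
have L10 : 0 < L + 1 by lra.
pose eta := Num.min (rho / 4) (e / 2 / (L + 1)).
have eta0 : 0 < eta by rewrite lt_min !divr_gt0.
have [d' d'0 d'P] := dist_of_near w eta0.
exists d' => // c /d'P[y -> yw] n; rewrite !iter_sphere_map.
apply: near_of_dist; rewrite cabsB.
move: yw; rewrite /eta lt_min => /andP[y1 y2].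
have := @poly_lipschitz R (iterp T n) w rho M rho0 _ y (ltW y1).
rewrite !iterpE -/L => lip.
have {lip} : cabs (orb n y - orb n w) <= L * cabs (y - w).
  apply: lip => x xw; rewrite iterpE; apply: bd.
  have := cabs_triangle w x z; rewrite /rho in xw; lra.
rewrite ltr_pdivlMr // in y2; have := cabs_ge0 (y - w); lra.
Qed.

Variable s : R.
Hypothesis s1 : 1 <= s.
Hypothesis sP : forall z, s <= cabs z -> 2 * cabs z <= cabs T.[z] /\
    forall n, 4 ^+ (D ^ n) <= cabs (orb n z).

Lemma escape_grows z n : s <= cabs z -> cabs z <= cabs (orb n z).
Proof.
move=> sz; elim: n => [//|n IH] /=.
have [+ _] := sP (le_trans sz IH); have := cabs_ge0 (orb n z); lra.
Qed.

Lemma escape_unbounded z M : s <= cabs z -> exists n, M < cabs (orb n z).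
Proof.
move=> sz; have [_ gr] := sP sz; exists (Num.bound `|M|).
apply: le_lt_trans (ler_norm M) _; apply: lt_le_trans (archi_boundP (normr_ge0 _)) _.
apply: le_trans (expr_ge_nat R _) _; apply: le_trans (gr _).
apply: (@le_trans _ _ (2 ^+ (D ^ Num.bound `|M|))).
  by rewrite ler_weXn2l ?ler1n // ltnW // ltn_expl // /D; lia.
by rewrite lerXn2r ?nnegrE // ler_nat.
Qed.

Lemma equicontinuous_at_infinity : equicontinuous_at (sphere_map T) None.
Proof.
move=> e e0; have [M MP] := near_infinity e0.
have [d d0 dP] := far_of_near (Num.max M s).
exists d => // -[z|] nz n; rewrite iter_sphere_map_infinity; last first.
  exact: ballxx.
rewrite iter_sphere_map; apply: MP; have := dP _ nz; rewrite gt_max => /andP[Mz sz].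
exact/ltW/(lt_le_trans Mz)/escape_grows/ltW.
Qed.

(** After finitely many steps a whole neighbourhood of z is close to infinity and
    stays there; the earlier iterates are finitely many continuous maps. *)
Lemma equicontinuous_at_escaping z k : s <= cabs (orb k z) ->
  equicontinuous_at (sphere_map T) (Some z).
Proof.
move=> sk e e0; have [M MP] := near_infinity (divr_gt0 e0 (ltr0n R 2)).
pose M' := Num.max M s.
have [j Mj] := escape_unbounded (M' + 1) sk.
have [d1 d10 d1P] := orbit_cont (j + k) z ltr01.
have [d2 d20 d2P] := orbit_cont_upto (j + k) z (divr_gt0 e0 (ltr0n R 2)).
have [d d0 dP] := @dist_of_near R z (Num.min d1 d2) ltac:(by rewrite lt_min d10).
exists d => // b /dP[y -> ]; rewrite lt_min => /andP[y1 y2] n; rewrite !iter_sphere_map.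
have [/d2P h|jn] := ltnP n (j + k).
  by apply: near_of_dist; rewrite cabsB; exact: h.
have far w : M' <= cabs (orb (j + k) w) -> near_on None (e / 2) (Some (orb n w)).
  rewrite ge_max => /andP[Mw sw]; apply: MP; apply: le_trans Mw _.
  have -> : orb n w = orb (n - (j + k)) (orb (j + k) w) by rewrite -iterD subnK.
  exact: escape_grows.
apply: (@ball_splitr _ _ (stereo None)); apply: far.
  by rewrite iterD; lra.
have := cabs_sub (orb (j + k) z) (orb (j + k) y); rewrite cabsB.
by have := d1P _ y1; rewrite [orb _ z]iterD; lra.
Qed.

Lemma escaping_Fatou z k : s <= cabs (orb k z) -> Fatou (sphere_map T) (Some z).
Proof.
move=> sk; apply/FatouP.
have sk1 : s + 1 <= cabs (orb k.+1 z).
  by have [h _] := sP sk; have h1 := s1; move: h sk h1; rewrite /=; lra.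
have [d d0 dP] := orbit_cont k.+1 z ltr01.
have [d' d'0 d'P] := dist_of_near z d0.
exists d' => // b /d'P[y -> /dP yz]; apply: (@equicontinuous_at_escaping y k.+1).
have := cabs_sub (orb k.+1 z) (orb k.+1 y); rewrite cabsB; lra.
Qed.

Lemma infinity_Fatou : Fatou (sphere_map T) None.
Proof.
apply/FatouP; have [d d0 dP] := far_of_near s.
exists d => // -[z|] nz; last exact: equicontinuous_at_infinity.
exact/(@equicontinuous_at_escaping z 0)/ltW/dP.
Qed.

End FatouSets.

(** * The inverse orbit of 0 and the Julia set *)

Section Attractor.
Variable R : realType.
Implicit Types (z w : R[i]) (a b c : riemann_sphere R) (e d : R).
Notation near_on := (@near_on_sphere R).

Lemma closure_complex (A : set R[i]^o) z : closure A (z : R[i]^o) <->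
  forall e, 0 < e -> exists2 y, A y & cabs (y - z) < e.
Proof.
have ballE e y : ball (z : R[i]^o) (e%:C%C) (y : R[i]^o) <-> cabs (y - z) < e.
  by rewrite -ball_normE /ball_ /= -cabsE ltcR cabsB.
split=> [cl e e0|cl B /nbhs_ballP[e /= e0 eB]].
  have [|y [Ay yz]] := cl (ball (z : R[i]^o) (e%:C%C)).
    by apply/nbhs_ballP; exists e%:C%C => //=; rewrite ltcR.
  by exists y => //; apply/ballE.
have er : e = (complex.Re e)%:C%C.
  by rewrite RRe_real // gtr0_real.
rewrite er ltcR in e0; have [y Ay yz] := cl _ e0.
exists y; split => //; apply: eB; rewrite er; exact/ballE.
Qed.

Lemma monomial_of_root0 (p : {poly R[i]}) : p.[1] = 1 ->
  (forall z, root p z -> z = 0) -> p = 'X^((size p).-1).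
Proof.
move=> p1 r0; have [rs rsE] := closed_field_poly_normal p.
have l0 : lead_coef p != 0.
  rewrite lead_coef_eq0; apply: contra_eq_neq p1 => ->.
  by rewrite horner0 eq_sym oner_eq0.
have rs0 : \prod_(z <- rs) ('X - z%:P) = 'X^(size rs).
  rewrite big_seq (eq_bigr (fun=> 'X)) => [|z zrs].
    by rewrite -big_seq big_const_seq count_predT -Monoid.iteropE.
  by rewrite (r0 z) ?subr0 // rsE rootZ // root_prod_XsubC.
rewrite rs0 in rsE; have l1 : lead_coef p = 1.
  by move: p1; rewrite rsE hornerZ hornerXn expr1n mulr1 -rsE.
by rewrite l1 scale1r in rsE; rewrite {2}rsE size_polyXn.
Qed.

Section Dynamics.
Variable T : {poly R[i]}.
Hypothesis T0 : T.[0] = 0.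
Variable a0 : R[i].
Hypothesis a0_neq0 : a0 != 0.
Hypothesis Ta0 : T.[a0] = 0.
Hypothesis T_neq0 : T != 0.
Notation orb n z := (iter n (horner T) z).

Lemma size_gt2 : (2 < size T)%N.
Proof.
apply: (@max_poly_roots _ T [:: 0; a0]) => //=.
  by rewrite /root T0 Ta0 !eqxx.
by rewrite inE eq_sym a0_neq0.
Qed.
Let T2 := size_gt2.

(** Either z escapes, or its orbit is bounded; in the second case
    orbit_stays_bounded bounds all orbits of a smaller disc. *)
Lemma Fatou_off_closure z r : 0 < r ->
  (forall y, cabs (y - z) < r -> ~ inverse_orbit T y) ->
  Fatou (sphere_map T) (Some z).
Proof.
move=> r0 miss; have [s s1 sP] := escape_radius T2.
have [[n sn]|bd] := pselect (exists n, s <= cabs (orb n z)).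
  exact: (escaping_Fatou T2 s1 sP sn).
have {}bd n : cabs (orb n z) <= s.
  by rewrite leNgt; apply/negP => h; apply: bd; exists n; exact: ltW.
have om n y : cabs (y - z) < r -> orb n y != 0.
  move=> /miss yO; apply/eqP => n0; apply: yO; exists n.+1 => //=.
  by rewrite n0.
apply: (@bounded_Fatou R T z (r / 2) s); first by rewrite divr_gt0.
move=> y yz n; apply: ltW.
apply: (@orbit_stays_bounded R T T2 T0 a0 a0_neq0 Ta0 z s r y s) => //.
  by move=> x /sP[].
exact: ltW.
Qed.

Lemma Julia_subset_closure :
  Julia T `<=` [set Some z | z in closure (inverse_orbit T)].
Proof.
move=> [z|] Jz; last first.
  by have [s s1 sP] := escape_radius T2; case: Jz; exact: (infinity_Fatou T2 s1 sP).
exists z => //; apply/closure_complex => e e0; apply: contrapT => no.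
apply: Jz; apply: (Fatou_off_closure e0) => y yz Oy; apply: no; exists y => //.
Qed.

(** The k-th iterate is an open map, so it sends some points close to y to small
    positive reals.  Their orbits reach modulus 1/2, whereas the orbit of y
    remains at 0. *)
Lemma not_equicontinuous_at_preimage k y :
  (forall x : R, 0 < x -> x < 1 -> exists n, 2^-1 <= cabs (orb n x%:C%C)) ->
  orb k y = 0 -> ~ equicontinuous_at (sphere_map T) (Some y).
Proof.
move=> rep yk eq.
have [e e0 eP] := @dist_of_near R 0 2^-1 ltac:(by rewrite invr_gt0).
have [d d0 dP] := eq e e0.
have [eta eta0 etaP] := poly_open y (size_iterp_gt1 T2 k) (divr_gt0 d0 (ltr0n R 2)).
pose x := Num.min (eta / 2) 2^-1.
have x0 : 0 < x by rewrite lt_min divr_gt0 //= invr_gt0.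
have x1 : x < 1 by rewrite gt_min invf_lt1 // ltr1n orbT.
have [|y' yy' y'x] := etaP x%:C%C.
  rewrite iterpE yk sub0r cabsN cabs_real gtr0_norm // gt_min; apply/orP; left; lra.
rewrite iterpE in y'x; have [n xn] := rep x x0 x1.
have := dP (Some y') _ (n + k)%N; rewrite !iter_sphere_map !iterD yk y'x orb0 //.
move=> h; have {}h := h (near_of_dist _).
have [|w [<-]] := eP _ (h _); first by rewrite cabsB.
by rewrite subr0; lra.
Qed.

Lemma closure_subset_Julia :
  (forall x : R, 0 < x -> x < 1 -> exists n, 2^-1 <= cabs (orb n x%:C%C)) ->
  [set Some z | z in closure (inverse_orbit T)] `<=` Julia T.
Proof.
move=> rep _ [z cz <-] /FatouP[e e0 eP].
have [y [k _ ky] yz] := (closure_complex _ _).1 cz _ (divr_gt0 e0 (ltr0n R 2)).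
apply: (not_equicontinuous_at_preimage rep ky); apply: eP; apply: near_of_dist.
by rewrite cabsB.
Qed.

Section Superattracting.
Variable q : {poly R[i]}.
Hypothesis TE : T = 'X^2 * q.

(** Near 0, T = X^2 q is a contraction, and the other roots of T stay away from
    0. *)
Lemma invariant_disc : exists2 d, 0 < d &
  forall w, cabs w < d -> cabs T.[w] <= cabs w /\ (T.[w] = 0 -> w = 0).
Proof.
have [M MP] := poly_bounded q 1.
have M0 : 0 <= M by apply: le_trans (MP 0 _); rewrite ?cabs_ge0 ?cabs0.
have [rs [_ rsE _]] := poly_factors T_neq0.
pose f (i : 'I_(size rs)) := if rs`_i == 0 then 1 else cabs rs`_i.
have [|d /andP[d0 d1] df] := @finite_lower_bound R _ f.
  by move=> i; rewrite /f; case: ifPn => // ?; rewrite cabs_gt0.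
have M10 : 0 < M + 1 by lra.
exists (Num.min d (1 / (M + 1))); first by rewrite lt_min d0 divr_gt0.
move=> w; rewrite lt_min ltr_pdivlMr // => /andP[wd wM]; split.
  rewrite TE hornerM hornerXn cabsM cabsX.
  have := MP w _; have := cabs_ge0 w; have := cabs_ge0 q.[w].
  move=> q0 w0 /(_ _)-h; have {}h : cabs q.[w] <= M by apply: h; lra.
  have : cabs w * cabs q.[w] <= 1.
    by apply: le_trans (ler_wpM2l w0 h) _; lra.
  move=> h2; rewrite expr2 -mulrA -[leRHS]mulr1; exact: ler_wpM2l.
move=> Tw; have wrs : w \in rs by rewrite rsE /root Tw eqxx.
have := df (Ordinal (etrans (index_mem w rs) wrs)).
rewrite /f /= nth_index //; case: eqVneq => // _ h.
by have := lt_le_trans wd h; rewrite ltxx.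
Qed.

Lemma invariant_disc_orbit d :
  (forall w, cabs w < d -> cabs T.[w] <= cabs w /\ (T.[w] = 0 -> w = 0)) ->
  forall n w, cabs w < d -> cabs (orb n w) <= cabs w /\ (orb n w = 0 -> w = 0).
Proof.
move=> dP n w wd; elim: n => [//|n [IH1 IH2]] /=.
have [h1 h2] := dP _ (le_lt_trans IH1 wd).
by split; [exact: le_trans IH1|move/h2/IH2].
Qed.

(** The k-th iterate maps a neighbourhood of z into the invariant disc around 0, so
    the orbits of that neighbourhood are uniformly bounded. *)
Lemma inverse_orbit_Fatou z : inverse_orbit T z -> Fatou (sphere_map T) (Some z).
Proof.
move=> [k _ zk]; have [d d0 dP] := invariant_disc.
have inv := invariant_disc_orbit dP.
have [d1 d10 d1P] := @orbit_cont R T k z d d0.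
have [d2 d20 d2P] := @orbit_cont_upto R T k z 1 ltr01.
have S0 : 0 <= \sum_(i < k) cabs (orb i z) by apply: sumr_ge0 => i _; exact: cabs_ge0.
apply: (@bounded_Fatou R T z (Num.min d1 d2) (\sum_(i < k) cabs (orb i z) + 1 + d)).
  by rewrite lt_min d10.
move=> y; rewrite lt_min => /andP[y1 y2] n; have [nk|kn] := ltnP n k.
  have := d2P _ y2 _ nk; have := cabs_sub (orb n y) (orb n z).
  have : cabs (orb n z) <= \sum_(i < k) cabs (orb i z).
    by rewrite (bigD1 (Ordinal nk)) //= lerDl; apply: sumr_ge0 => i _; exact: cabs_ge0.
  lra.
have := d1P _ y1; rewrite [orb k z]zk subr0 => yk.
have -> : orb n y = orb (n - k) (orb k y) by rewrite -iterD subnK.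
have [+ _] := inv (n - k)%N _ yk; lra.
Qed.

(** By equicontinuity z enters the invariant disc at the time m at which some nearby
    preimage y of 0 reaches 0.  The preimages of 0 close to z enter it at the same
    time and, as 0 has no other preimage in the disc, are at 0 at time m; by
    continuity so is z. *)
Lemma closure_in_Fatou z : closure (inverse_orbit T) z ->
  Fatou (sphere_map T) (Some z) -> inverse_orbit T z.
Proof.
move=> /closure_complex cz /FatouP[e' e'0 /(_ _ (ballxx _ e'0)) eq].
have [d d0 dP] := invariant_disc; have inv := invariant_disc_orbit dP.
have [e e0 eP] := @dist_of_near R 0 d d0.
have [d1 d10 d1P] := eq e e0.
have [y [m m0 my] yz] := cz _ (divr_gt0 d10 (ltr0n R 2)).
have zm : cabs (orb m z) < d.
  have h := d1P (Some y) (near_of_dist _); rewrite cabsB in h.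
  have {}h := h yz m; rewrite !iter_sphere_map my in h.
  by have [w [<-]] := eP _ (ball_sym h); rewrite subr0.
exists m => //=; apply/eqP; rewrite -cabs_eq0 eq_le cabs_ge0 andbT leNgt.
apply/negP => zm0.
have eta0 : 0 < Num.min (cabs (orb m z)) (d - cabs (orb m z)).
  by rewrite lt_min zm0 subr_gt0.
have [d2 d20 d2P] := @orbit_cont R T m z _ eta0.
have [x [j _ jx] xz] := cz _ d20.
have := d2P _ xz; rewrite lt_min => /andP[c1 c2].
have xm : cabs (orb m x) < d by have := cabs_sub (orb m x) (orb m z); lra.
have [_ x0] := inv j _ xm.
move: c1; rewrite x0 ?sub0r ?cabsN ?ltxx //.
by rewrite -iterD addnC iterD jx orb0.
Qed.

Lemma closure_superattracting :
  [set Some z | z in closure (inverse_orbit T)]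
     = [set Some z | z in inverse_orbit T] `|` Julia T /\
  [set Some z | z in inverse_orbit T] `&` Julia T = set0.
Proof.
split; last first.
  by apply/seteqP; split=> // _ [[z Oz <-]]; apply; exact: inverse_orbit_Fatou.
apply/seteqP; split=> [_ [z cz <-]|a [[z Oz <-]|]].
- have [Fz|] := pselect (Fatou (sphere_map T) (Some z)); last by right.
  by left; exists z => //; exact: closure_in_Fatou.
- by exists z => //; exact: subset_closure.
- exact: Julia_subset_closure.
Qed.

End Superattracting.
End Dynamics.

(** An orbit that stays below 1/2 increases, and its supremum L satisfies p(L) > L; by
    continuity the orbit would pass beyond L. *)
Lemma real_orbit_escapes (p : {poly R}) :
  (forall x, 0 < x -> x < 1 -> x < p.[x] <= 1) ->
  forall x, 0 < x -> x < 1 -> exists n, 2^-1 <= iter n (horner p) x.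
Proof.
move=> px x x0 x1; apply: contrapT => no.
have u2 n : iter n (horner p) x < 2^-1.
  by rewrite ltNge; apply/negP => h; apply: no; exists n.
have half : 2^-1 < 1 :> R by rewrite invf_lt1 ?ltr1n.
have u0 n : 0 < iter n (horner p) x.
  elim: n => [//|n IH] /=.
  by have /andP[h _] := px _ IH (lt_trans (u2 n) half); exact: lt_trans IH h.
pose U := range (fun n => iter n (horner p) x).
have hU : has_sup U.
  split; first by exists x; exists 0%N.
  by exists 2^-1 => _ [n _ <-]; exact: ltW.
pose L := sup U.
have uL n : iter n (horner p) x <= L by have := ub_le_sup hU.2; apply; exists n.
have L0 : 0 < L := lt_le_trans (u0 0%N) (uL 0%N).
have L1 : L < 1.
  apply: le_lt_trans half; apply: ge_sup; first exact: hU.1.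
  by move=> _ [n _ <-]; exact: ltW.
have /andP[fL _] := px _ L0 L1.
have : \forall y \near L, L < p.[y] by apply: (cvgr_gt _ (@continuous_horner R p L)).
case/nbhs_ballP => d /= d0 dP.
have [_ [n _ <-] un] := sup_adherent d0 hU.
have := uL n.+1; rewrite /= leNgt => /negP; apply; apply: dP.
rewrite -ball_normE /ball_ /= ger0_norm ?subr_ge0 //; rewrite -/L in un; lra.
Qed.

End Attractor.

Theorem theorem4p1 (R : realType) (G : ttgraph)
    (G_connected : connected_graph G)
    (G_order : (2 <= #|vertex G|)%N)
    (G_size : (2 <= #|edge G|)%N)
    (G_relevant : forall e : edge G, on_st_path e)
    (G_not_path : ~ is_st_path G)
    (o : nat -> edge G -> bool) :
  let T : {poly R[i]} := Rel R[i] G in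
  (adj (src G) (tgt G) ->
     [set Some z | z in attractor R o] = Julia T) /\
  (~~ adj (src G) (tgt G) ->
     [set Some z | z in attractor R o]
       = [set Some z | z in inverse_orbit T] `|` Julia T /\
     [set Some z | z in inverse_orbit T] `&` Julia T = set0).
Proof.
move=> T.
have T0 : T.[0] = 0 by exact: Rel0.
have T1 : T.[1] = 1 by exact: Rel1.
have TN0 : T != 0.
  by apply: contra_eq_neq T1 => ->; rewrite horner0 eq_sym oner_eq0.
have [a a_neq0 Ta] : exists2 a, a != 0 & T.[a] = 0.
  apply: contrapT => no; apply: G_not_path.
  apply: (@Rel_monomial_path G R[i] (size T).-1) => //; first exact: ltnW.
  apply: (monomial_of_root0 T1) => z /rootP Tz; apply: contrapT => /eqP z0.
  by apply: no; exists z.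
have -> : attractor R o = closure (inverse_orbit T).
  congr closure; apply/seteqP; split=> [z [k _ /= /rootP]|z [k /= k0 kz]].
    by rewrite Rel_iter_subst => kz; exists k.+1.
  by exists k.-1 => //=; apply/rootP; rewrite Rel_iter_subst prednK.
split=> [Gadj|Gnadj]; last first.
  have [q [Tq _]] := Rel_lowest R[i] (fun S => connecting_card_gt1 Gnadj (S := S)).
  exact: (closure_superattracting T0 a_neq0 Ta TN0 Tq).
apply/seteqP; split; last exact: (Julia_subset_closure T0 a_neq0 Ta TN0).
apply: (closure_subset_Julia T0 a_neq0 Ta TN0) => x x0 x1.
have [|n xn] := @real_orbit_escapes R (Rel R G) _ x x0 x1.
  by move=> y y0 y1; rewrite Rel_gt_id // Rel_le1.
exists n; have -> : iter n (horner T) x%:C%C = (iter n (horner (Rel R G)) x)%:C%C.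
  by elim: n {xn} => //= n ->; rewrite (Rel_morph _ (real_complex R)).
by rewrite cabs_real; exact: le_trans (ler_norm _).
Qed.
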